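(* Let $n\ge1$. There exist non-zero scalars $q_1,q_2$ such that, in $\left(\bigwedge (M_{2n}^+)^*\otimes M_{2n}\right)^{SO(2n)}$, $$X^{4n-2}=q_1\, Q\wedge\Omega,\qquad X^{4n-1}=q_2\, Q\wedge d\Omega .$$
   Context: $M_{2n}$ denotes the complex $2n\times 2n$ matrices, $M_{2n}^+$ (resp. $M_{2n}^-$) the symmetric (resp. skew-symmetric) ones; $G=SO(2n)$ (complex) acts by conjugation. For $R=M_{2n}$ or $R=\mathbb C$, $\bigwedge^k (M_{2n}^+)^*\otimes R$ is identified with alternating $k$-linear maps $(M_{2n}^+)^k\to R$, with product $$(F\wedge H)(v_1,\dots,v_{h+k})=\frac1{h!k!}\sum_{\sigma\in S_{h+k}}\epsilon_\sigma F(v_{\sigma(1)},\dots,v_{\sigma(h)})H(v_{\sigma(h+1)},\dots,v_{\sigma(h+k)}),$$ and likewise for a scalar-valued map times a matrix-valued one. $X\in (M_{2n}^+)^*\otimes M_{2n}$ is the inclusion map $M_{2n}^+\to M_{2n}$ and $X^a=X^{\wedge a}$, i.e. the standard polynomial $St_a(X_1,\dots,X_a)=\sum_{\sigma\in S_a}\epsilon_\sigma X_{\sigma(1)}\cdots X_{\sigma(a)}$ on symmetric matrices. Polarized pfaffian: $Q(Y_1,\dots,Y_n)$ is the symmetric $n$-linear function on $M_{2n}$ that depends only on the skew parts $(Y_i-Y_i^t)/2$ and is the full polarization of the pfaffian $Pf$ there, normalized so that $Q(u_1\otimes u_2,\dots,u_{2n-1}\otimes u_{2n})=\det[u_1,\dots,u_{2n}]$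 for $u_i\in\mathbb C^{2n}$, where $u\otimes v$ is the matrix $uv^t$. The invariant $Q\in\left(\bigwedge^{2n}(M_{2n}^+)^*\right)^G$ (same letter) is $$Q=\sum_{\sigma\in S_{2n}}\epsilon_\sigma\,Q([X_{\sigma(1)},X_{\sigma(2)}],\dots,[X_{\sigma(2n-1)},X_{\sigma(2n)}]).$$ With $e_1,\dots,e_{2n}$ the standard orthonormal basis of $\mathbb C^{2n}$ and $e_i\wedge e_j=e_i\otimes e_j-e_j\otimes e_i\in M_{2n}^-$, define $\Omega\in\left(\bigwedge^{2n-2}(M_{2n}^+)^*\otimes M_{2n}^-\right)^G$ by $$\Omega(X_1,\dots,X_{2n-2})=\sum_{i<j}\sum_{\sigma\in S_{2n-2}}\epsilon_\sigma\,Q([X_{\sigma(1)},X_{\sigma(2)}],\dots,[X_{\sigma(2n-3)},X_{\sigma(2n-2)}],e_i\wedge e_j)\,e_i\wedge e_j ,$$ and $d\Omega\in\left(\bigwedge^{2n-1}(M_{2n}^+)^*\otimes M_{2n}^-\right)^G$ by $$d\Omega(X_1,\dots,X_{2n-1})=\sum_{h=1}^{2n-1}(-1)^h\,X_h\cdot\Omega(X_1,\dots,\widehat{X_h},\dots,X_{2n-1}),\qquad X\cdot Y:=XY+YX^t .$$ *)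

(* Defs.v *)
From HB Require Import structures.
From mathcomp Require Import all_boot all_order all_fingroup all_algebra.
From mathcomp Require Import complex.
From mathcomp Require Import reals.
From mathcomp Require Import zify.

Set Implicit Arguments.
Unset Strict Implicit.
Unset Printing Implicit Defensive.

Import Order.TTheory GRing.Theory Num.Theory.
Local Open Scope ring_scope.

Section Forms.
Variables (K : numFieldType) (m : nat).

Definition symmx : {pred 'M[K]_m} := [pred A | A^T == A].

Lemma symmx_submod : submod_closed symmx.
Proof.
split=> [|a A B /eqP hA /eqP hB]; rewrite inE ?trmx0 //.
by rewrite linearD linearZ /= hA hB.
Qed.
HB.instance Definition _ := GRing.isSubmodClosed.Build K 'M[K]_m symmx symmx_submod.

(* M_m^+ *)
Record symM := SymM { symval :> 'M[K]_m; symvalP : symval \in symmx }.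
HB.instance Definition _ := [isSub for symval].
HB.instance Definition _ := [Choice of symM by <:].
HB.instance Definition _ := [SubChoice_isSubLmodule of symM by <:].

Definition skew_part (A : 'M[K]_m) : 'M[K]_m := 2^-1 *: (A - A^T).

Definition lie (A B : 'M[K]_m) : 'M[K]_m := A *m B - B *m A.

Definition tens (u v : 'cV[K]_m) : 'M[K]_m := u *m v^T.

Definition ebasis (i : 'I_m) : 'cV[K]_m := delta_mx i 0.

Definition ewedge (i j : 'I_m) : 'M[K]_m :=
  tens (ebasis i) (ebasis j) - tens (ebasis j) (ebasis i).

(* Complex special orthogonal group: A^T is the plain transpose. *)
Definition SO : {pred 'M[K]_m} := [pred g | (g *m g^T == 1%:M) && (\det g == 1)].

Lemma symM_congr_subproof (g : 'M[K]_m) (A : symM) : g *m A *m g^T \in symmx.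
Proof.
by case: A => A hA; rewrite inE /= !trmx_mul trmxK (eqP hA) mulmxA.
Qed.

(* For g in SO this is conjugation, since then g^-1 = g^T. *)
Definition symM_conj (g : 'M[K]_m) (A : symM) : symM :=
  SymM (symM_congr_subproof g A).

End Forms.

Arguments SO : clear implicits.
Arguments symmx : clear implicits.
Arguments ewedge : clear implicits.

Section Multilinear.
Variables (K : numFieldType) (U V : lmodType K).

Definition vperm k (v : {ffun 'I_k -> U}) (s : 'S_k) : {ffun 'I_k -> U} :=
  [ffun i => v (s i)].

Definition vset k (v : {ffun 'I_k -> U}) (i : 'I_k) (x : U) : {ffun 'I_k -> U} :=
  [ffun j => if j == i then x else v j].

Definition multilinear k (F : {ffun 'I_k -> U} -> V) : Prop :=
  forall (v : {ffun 'I_k -> U}) i (a : K) (x y : U),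
    F (vset v i (a *: x + y)) = a *: F (vset v i x) + F (vset v i y).

Definition alternating k (F : {ffun 'I_k -> U} -> V) : Prop :=
  forall (v : {ffun 'I_k -> U}) i j, i != j -> v i = v j -> F v = 0.

Definition wedge h k (F : {ffun 'I_h -> U} -> K) (H : {ffun 'I_k -> U} -> V)
    (v : {ffun 'I_(h + k) -> U}) : V :=
  (h`! * k`!)%:R^-1 *:
    \sum_(s : 'S_(h + k)) (-1) ^+ s *:
      (F [ffun i => v (s (lshift k i))] *: H [ffun i => v (s (rshift h i))]).

Definition castdeg d d' (e : d = d') (F : {ffun 'I_d -> U} -> V)
    (v : {ffun 'I_d' -> U}) : V :=
  F [ffun i => v (cast_ord e i)].

End Multilinear.

(* F lies in (/\^k (M_m^+)^* (x) M_m)^{SO(m)}. *)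
Definition covariant (K : numFieldType) (m k : nat)
    (F : {ffun 'I_k -> symM K m} -> 'M[K]_m) : Prop :=
  [/\ multilinear F, alternating F &
      forall g (v : {ffun 'I_k -> symM K m}), g \in SO K m ->
        F [ffun i => symM_conj g (v i)] = g *m F v *m invmx g].

(* Equality as elements of that space. *)
Definition covariant_eq (K : numFieldType) (m k : nat)
    (F H : {ffun 'I_k -> symM K m} -> 'M[K]_m) : Prop :=
  [/\ covariant F, covariant H & F =1 H].

(* The inclusion X to the power a, as the standard polynomial St_a. *)
Definition Xpow (K : numFieldType) (m a : nat)
    (v : {ffun 'I_a -> symM K m}) : 'M[K]_m :=
  \sum_(s : 'S_a) (-1) ^+ s *: \prod_(i < a) (v (s i) : 'M[K]_m).

Arguments Xpow : clear implicits.

Section Pfaffian.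
Variables (K : numFieldType) (n : nat).

Lemma ord_ev_subproof (k : 'I_n) : (k.*2 < n.*2)%N.
Proof. by rewrite ltn_double. Qed.
Definition ord_ev (k : 'I_n) : 'I_(n.*2) := Ordinal (ord_ev_subproof k).

Lemma ord_od_subproof (k : 'I_n) : (k.*2.+1 < n.*2)%N.
Proof. by rewrite ltn_Sdouble. Qed.
Definition ord_od (k : 'I_n) : 'I_(n.*2) := Ordinal (ord_od_subproof k).

Definition pfsum (Y : {ffun 'I_n -> 'M[K]_(n.*2)}) : K :=
  \sum_(s : 'S_(n.*2)) (-1) ^+ s * \prod_(k < n) Y k (s (ord_ev k)) (s (ord_od k)).

Definition pfaffian (A : 'M[K]_(n.*2)) : K :=
  (2 ^ n * n`!)%:R^-1 * pfsum [ffun=> A].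

(* Explicit form of the polarized pfaffian; its defining properties, including
   the normalization that (with multilinearity) determines it, are polpf_multilinear, polpf_sym,
   polpf_skew_part, polpf_diag and polpf_tens below. *)
Definition polpf (Y : {ffun 'I_n -> 'M[K]_(n.*2)}) : K :=
  pfsum [ffun k => skew_part (Y k)].

End Pfaffian.

Section Covariants.
Variables (K : numFieldType) (n : nat).
Notation M := 'M[K]_(n.*2).
Notation MS := (symM K n.*2).

Definition Qform (v : {ffun 'I_(n.*2) -> MS}) : K :=
  \sum_(s : 'S_(n.*2)) (-1) ^+ s *
    polpf [ffun k : 'I_n => lie (v (s (ord_ev k))) (v (s (ord_od k)))].

(* The arguments ([v_1, v_2], ..., [v_(2n-3), v_(2n-2)], Z) of Q: [insub] is
   [Some] on the first n - 1 indices and [None] on the last one. *)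
Definition Omega_args (v : {ffun 'I_(n.-1.*2) -> MS}) (Z : M) : {ffun 'I_n -> M} :=
  [ffun k : 'I_n =>
     if insub (k : nat) is Some j then lie (v (ord_ev j)) (v (@ord_od n.-1 j))
     else Z].

Definition Omega (v : {ffun 'I_(n.-1.*2) -> MS}) : M :=
  \sum_(i < n.*2) \sum_(j < n.*2 | (i < j)%N) \sum_(s : 'S_(n.-1.*2))
    ((-1) ^+ s * polpf (Omega_args (vperm v s) (ewedge K n.*2 i j))) *: ewedge K n.*2 i j.

Definition skew_act (A B : M) : M := A *m B + B *m A^T.

(* Indices start at 0, hence the sign (-1) ^+ h.+1; [v \o lift h] omits v_h. *)
Definition dOmega (v : {ffun 'I_(n.-1.*2.+1) -> MS}) : M :=
  \sum_(h < n.-1.*2.+1)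
    (-1) ^+ h.+1 *: skew_act (v h) (Omega [ffun i => v (lift h i)]).

End Covariants.

Arguments Qform : clear implicits.
Arguments Omega : clear implicits.
Arguments dOmega : clear implicits.

Lemma deg_QOmega n : (0 < n)%N -> (n.*2 + n.-1.*2 = 4 * n - 2)%N.
Proof. by case: n => // n _; lia. Qed.

Lemma deg_QdOmega n : (0 < n)%N -> (n.*2 + n.-1.*2.+1 = 4 * n - 1)%N.
Proof. by case: n => // n _; lia. Qed.

Section PolarizedPfaffianTheory.
Variables (K : numFieldType) (n : nat).
Notation M := 'M[K]_(n.*2).
Implicit Types Y : {ffun 'I_n -> M}.

Lemma ord_ev_inj : injective (@ord_ev n).
Proof. by move=> i j /(congr1 val) /= /double_inj /val_inj. Qed.

Lemma ord_od_inj : injective (@ord_od n).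
Proof. by move=> i j /(congr1 val) /= [] /double_inj /val_inj. Qed.

Lemma ord_ev_od (i j : 'I_n) : (ord_ev i == ord_od j) = false.
Proof. by apply/eqP => /(congr1 (odd \o val)) /=; rewrite !odd_double. Qed.

Lemma ord_od_ev (i j : 'I_n) : (ord_od i == ord_ev j) = false.
Proof. by rewrite eq_sym ord_ev_od. Qed.

Lemma pfsum_multilinear : multilinear (V := K^o) (@pfsum K n).
Proof.
move=> v i a x y; rewrite /pfsum scaler_sumr -big_split; apply: eq_bigr => s _ /=.
have E z : \prod_(k < n) (vset v i z) k (s (ord_ev k)) (s (ord_od k)) =
    z (s (ord_ev i)) (s (ord_od i)) *
    \prod_(k < n | k != i) v k (s (ord_ev k)) (s (ord_od k)).
  rewrite (bigD1 i) //= ffunE eqxx; congr (_ * _).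
  by apply: eq_bigr => k /negbTE hk; rewrite ffunE hk.
rewrite !E !mxE /GRing.scale /= mulrDl mulrDr; congr (_ + _).
by rewrite -mulrA mulrCA.
Qed.

Lemma pfsum_reindex (t : 'S_(n.*2)) Y :
  pfsum Y = (-1) ^+ t * \sum_(s : 'S_(n.*2)) (-1) ^+ s *
    \prod_(k < n) Y k (s (t (ord_ev k))) (s (t (ord_od k))).
Proof.
rewrite /pfsum (reindex_inj (mulgI t)) mulr_sumr; apply: eq_bigr => s _.
rewrite odd_permM signr_addb mulrA; congr (_ * _).
by apply: eq_bigr => k _; rewrite !permM.
Qed.

Lemma pfsum_tr Y i : pfsum (vset Y i (Y i)^T) = - pfsum Y.
Proof.
rewrite (pfsum_reindex (tperm (ord_ev i) (ord_od i))) odd_tperm ord_ev_od /=.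
rewrite expr1 mulN1r; congr (- _); apply: eq_bigr => s _; congr (_ * _).
apply: eq_bigr => k _; rewrite ffunE; case: eqVneq => [->|hk].
  by rewrite tpermL tpermR mxE.
rewrite eq_sym in hk.
by rewrite !tpermD ?ord_ev_od ?ord_od_ev ?(inj_eq ord_ev_inj) ?(inj_eq ord_od_inj).
Qed.

Lemma pfsum_skew1 Y i : pfsum (vset Y i (skew_part (Y i))) = pfsum Y.
Proof.
have -> : skew_part (Y i) = 2^-1 *: Y i + (- 2^-1 *: (Y i)^T + 0).
  by rewrite /skew_part scalerBr scaleNr addr0.
have Z0 : pfsum (vset Y i 0) = 0.
  have := pfsum_multilinear Y i 1 0 0.
  rewrite scaler0 addr0 scale1r => /eqP.
  by rewrite -[X in X == _]addr0 (inj_eq (addrI _)) eq_sym => /eqP.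
rewrite pfsum_multilinear pfsum_multilinear pfsum_tr Z0 addr0.
have -> : vset Y i (Y i) = Y by apply/ffunP => j; rewrite ffunE; case: eqVneq => [->|].
rewrite scaleNr scalerN opprK -scalerDl.
have -> : 2^-1 + 2^-1 = 1 :> K by rewrite [RHS]splitr div1r.
by rewrite scale1r.
Qed.

Lemma polpfE Y : polpf Y = pfsum Y.
Proof.
have H (r : seq 'I_n) : uniq r ->
    pfsum [ffun k => if k \in r then skew_part (Y k) else Y k] = pfsum Y.
  elim: r => [_|i r IH /= /andP[hi /IH {IH} <-]].
    by congr pfsum; apply/ffunP => k; rewrite ffunE.
  rewrite -(pfsum_skew1 [ffun k => if k \in r then _ else _] i).
  congr pfsum; apply/ffunP => k; rewrite !ffunE inE (negbTE hi).
  by case: eqVneq => [->|].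
rewrite -(H _ (enum_uniq 'I_n)); congr pfsum; apply/ffunP => k.
by rewrite !ffunE mem_enum.
Qed.

Lemma polpf_multilinear : multilinear (V := K^o) (@polpf K n).
Proof. by move=> v i a x y; rewrite !polpfE pfsum_multilinear. Qed.

Lemma polpf_skew_part Y : polpf [ffun k => skew_part (Y k)] = polpf Y.
Proof. by rewrite polpfE. Qed.

Lemma pfsum_tperm Y i j : pfsum (vperm Y (tperm i j)) = pfsum Y.
Proof.
case: (eqVneq i j) => [->|hij].
  by congr pfsum; apply/ffunP => k; rewrite ffunE tperm1 perm1.
rewrite [RHS](pfsum_reindex
  (tperm (ord_ev i) (ord_ev j) * tperm (ord_od i) (ord_od j))%g).
rewrite odd_permM !odd_tperm (inj_eq ord_ev_inj) (inj_eq ord_od_inj) hij mul1r.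
rewrite /pfsum [RHS](_ : _ = \sum_(s : 'S_(n.*2)) (-1) ^+ s *
    \prod_(k < n) Y k (s (ord_ev (tperm i j k))) (s (ord_od (tperm i j k)))).
  apply: eq_bigr => s _; congr (_ * _); rewrite (reindex_inj (@perm_inj _ (tperm i j))).
  by apply: eq_bigr => k _; rewrite ffunE !tpermK.
apply: eq_bigr => s _; congr (_ * _); apply: eq_bigr => k _; rewrite !permM.
rewrite (tpermD (z := ord_od k)) ?ord_ev_od // [X in Y k (s X)](_ : _ = ord_ev (tperm i j k)).
  congr (Y k _ (s _)).
  case: tpermP => [->|->|/eqP h1 /eqP h2]; rewrite ?tpermL ?tpermR //.
  by rewrite tpermD // (inj_eq ord_od_inj) eq_sym.
case: (tpermP i j k) => [->|->|/eqP h1 /eqP h2]; rewrite ?tpermL ?tpermR.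
- by rewrite tpermD // ord_od_ev.
- by rewrite tpermD // ord_od_ev.
rewrite (tpermD (x := ord_ev i)) ?(inj_eq ord_ev_inj) 1?eq_sym //.
by rewrite tpermD // ord_od_ev.
Qed.

Lemma polpf_sym Y (s : 'S_n) : polpf (vperm Y s) = polpf Y.
Proof.
rewrite !polpfE; have [ts -> _] := prod_tpermP s.
elim: ts Y => [|t ts IH] Y.
  by rewrite big_nil; congr pfsum; apply/ffunP => k; rewrite ffunE perm1.
rewrite big_cons -[RHS]IH -[RHS](pfsum_tperm _ t.1 t.2); congr pfsum.
by apply/ffunP => k; rewrite !ffunE permM.
Qed.

Lemma polpf_diag (A : M) :
  polpf [ffun=> A] = (2 ^ n * n`!)%:R * pfaffian (skew_part A).
Proof.
rewrite /pfaffian mulrA divff ?mul1r; last first.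
  by rewrite pnatr_eq0 muln_eq0 expn_eq0 /= -lt0n fact_gt0.
by congr pfsum; apply/ffunP => k; rewrite !ffunE.
Qed.

Lemma prod_ord_double (F : 'I_(n.*2) -> K) :
  \prod_a F a = \prod_k (F (ord_ev k) * F (ord_od k)).
Proof.
pose f (p : 'I_n * bool) := if p.2 then ord_od p.1 else ord_ev p.1.
have hlt (a : 'I_(n.*2)) : (a./2 < n)%N by have := ltn_ord a; lia.
pose g (a : 'I_(n.*2)) := (Ordinal (hlt a), odd a).
have fK : cancel f g.
  case=> k [] /=; congr pair; rewrite /f /= ?odd_double //; apply: val_inj => /=.
    by rewrite uphalf_double.
  by rewrite doubleK.
have gK : cancel g f.
  by move=> a; apply: val_inj; rewrite /f /g /=; case: ifP => /= h; lia.
rewrite (reindex f) /=; last by exists g => x _; [apply: fK | apply: gK].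
rewrite -(pair_bigA _ (fun k b => F (f (k, b)))) /=; apply: eq_bigr => k _.
by rewrite big_bool mulrC.
Qed.

Lemma polpf_tens (u : 'I_(n.*2) -> 'cV[K]_(n.*2)) :
  polpf [ffun k => tens (u (ord_ev k)) (u (ord_od k))] =
  \det (\matrix_(i, j) u j i 0).
Proof.
rewrite polpfE -det_tr; apply: eq_bigr => s _; congr (_ * _).
rewrite prod_ord_double; apply: eq_bigr => k _.
by rewrite ffunE !mxE big_ord1 !mxE.
Qed.

End PolarizedPfaffianTheory.

(* Main.v *)
Require Import Defs.
From HB Require Import structures.
From mathcomp Require Import all_boot all_order all_fingroup all_algebra.
From mathcomp Require Import complex.
From mathcomp Require Import reals.
From mathcomp Require Import zify ring.

(** Let [m = 2n].  Encode alternating forms in [d] symmetric matrices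
    [X_1, ..., X_d] in the Grassmann algebra on [theta_1, ..., theta_d]: with
    [X = sum_i theta_i X_i], the top coefficient of [X ^ d] is
    [St_d(X_1, ..., X_d)].  The matrix [A = X ^ 2] is skew-symmetric with entries
    in the commutative even part, and up to scalars [Q] is [Pf A] and [Omega] is
    the Pfaffian adjugate [D] of [A].  Over every torsion-free commutative ring
    [Pf A * D] is a constant multiple of the adjugate of [A].  As the entries of
    [X] anticommute, [tr (X ^ 2k) = 0] for [k > 0], so [A] has characteristic
    polynomial [t ^ m] and its adjugate is [- A ^ (m - 1) = - X ^ (4n - 2)].  This
    is the first identity; multiplying it by [X] on the left and on the right and
    adding the results gives the second. *)

Set Implicit Arguments.
Unset Strict Implicit.
Unset Printing Implicit Defensive.

Import Order.TTheory GRing.Theory Num.Theory.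
Local Open Scope ring_scope.

(** * The Grassmann algebra *)

(** Over a field the relation between [\adj A] and [Pf A * D] follows from [A * D = Pf A] and
    [det A = (Pf A)^2] by cancelling [Pf A]. Here [Pf A] is a form of positive degree, hence
    nilpotent, and nothing can be cancelled. The cancellation is done over a polynomial ring
    instead, on a path from a matrix with regular Pfaffian to [A], before specializing. The facts
    needed about Pfaffians come from their behaviour under congruence, which is clear once a
    Pfaffian is read as the top coefficient of a product of 2-forms. So Grassmann algebras occur
    twice: with one generator for each symmetric matrix, and with one generator for each row, the
    latter over the even part of the former or over polynomials. Hence the base is an arbitrary
    commutative ring, and the even part is made into a commutative ring of its own, where
    determinants and Cayley-Hamilton apply. The only divisors are integers, which is why
    torsion-freeness is the recurring hypothesis. *)

Definition inversions d (A B : {set 'I_d}) : nat :=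
  \sum_(a in A) \sum_(b in B) (b < a)%N.

Lemma inversions0s d (A : {set 'I_d}) : inversions set0 A = 0%N.
Proof. by rewrite /inversions big_set0. Qed.

Lemma inversionss0 d (A : {set 'I_d}) : inversions A set0 = 0%N.
Proof. by rewrite /inversions big1 // => a _; rewrite big_set0. Qed.

Lemma inversionsUl d (A B C : {set 'I_d}) : [disjoint A & B] ->
  inversions (A :|: B) C = (inversions A C + inversions B C)%N.
Proof.
move=> dAB; rewrite /inversions -bigU //=.
by apply: eq_bigl => i; rewrite !inE.
Qed.

Lemma inversionsUr d (A B C : {set 'I_d}) : [disjoint B & C] ->
  inversions A (B :|: C) = (inversions A B + inversions A C)%N.
Proof.
move=> dBC; rewrite /inversions -big_split; apply: eq_bigr => a _ /=.
by rewrite -bigU //=; apply: eq_bigl => i; rewrite !inE.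
Qed.

(** Every pair from [A] and [B] is inverted in exactly one of the two orders; the parity of the
    product gives the sign in [homog_comm]. *)
Lemma inversions_sym d (A B : {set 'I_d}) : [disjoint A & B] ->
  (inversions A B + inversions B A = #|A| * #|B|)%N.
Proof.
move=> dAB; rewrite /inversions [X in (_ + X)%N]exchange_big -big_split /=.
rewrite -[RHS]sum_nat_const; apply: eq_bigr => a aA.
rewrite -big_split -sum1_card; apply: eq_bigr => b bB /=.
case: (ltngtP a b) => // /val_inj eab.
by move/pred0P/(_ a): dAB; rewrite /= aA eab bB.
Qed.

(* [f : grass K d] is [\sum_S f S * theta_S], where [theta_S] is the increasing
   product of the generators in [S]; reordering [theta_A theta_B] into
   [theta_(A :|: B)] costs the sign [(-1) ^+ inversions A B]. *)
Definition grass (K : comNzRingType) (d : nat) := {ffun {set 'I_d} -> K^o}.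
HB.instance Definition _ (K : comNzRingType) d :=
  GRing.Lmodule.copy (grass K d) {ffun {set 'I_d} -> K^o}.

Section GrassmannRing.
Variables (K : comNzRingType) (d : nat).
Notation G := (grass K d).
Implicit Types (f g h : G) (A B S T : {set 'I_d}).

Definition gone : G := [ffun S : {set 'I_d} => (S == set0)%:R].

Definition gmul f g : G :=
  [ffun S : {set 'I_d} => \sum_(A : {set 'I_d} | A \subset S)
     (-1) ^+ inversions A (S :\: A) * (f A * g (S :\: A))].

Lemma gmulA : associative gmul.
Proof.
move=> f g h; apply/ffunP => S; rewrite !ffunE.
under eq_bigr do rewrite ffunE !mulr_sumr.
under [RHS]eq_bigr do rewrite ffunE mulr_suml mulr_sumr.
rewrite [RHS](exchange_big_dep (fun A => A \subset S)) /=; last first.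
  by move=> T A sTS sAT; apply: subset_trans sTS.
apply: eq_bigr => A sAS.
(* Both sides are sums over ordered partitions of [S] into three blocks; here [T] is replaced by its
   second block [T :\: A]. *)
rewrite [RHS](reindex_onto (fun B => A :|: B) (fun T => T :\: A)) /=; last first.
  by move=> T /andP[_ sAT]; rewrite setDUr setDv set0U setIC setDE -setDDr setDv setD0
     || (apply/setP => x; rewrite !inE; case: (boolP (x \in A)) => //= /(subsetP sAT) ->).
apply: eq_big => B.
  rewrite subsetUl andbT subUset sAS /= subsetD; congr (_ && _).
  rewrite setDUl setDv set0U; apply/idP/eqP => [dBA|<-].
    by apply/setDidPl.
  by rewrite disjoint_sym disjoints_subset setCD subsetUr.
rewrite subsetD => /andP[sBS dBA].
have -> : (A :|: B) :\: A = B by rewrite setDUl setDv set0U; apply/setDidPl.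
rewrite setDDl.
have eSA : S :\: A = B :|: (S :\: (A :|: B)).
  apply/setP => x; rewrite !inE; case: (boolP (x \in B)) => //= xB.
    by rewrite (subsetP sBS) // andbT; move/pred0P/(_ x): dBA; rewrite /= xB /= => ->.
  by rewrite orbF.
have d1 : [disjoint B & S :\: (A :|: B)].
  by apply/pred0P => x; rewrite /= !inE; case: (x \in B); rewrite ?orbT ?andbF.
rewrite [in inversions A _]eSA (inversionsUr _ d1) inversionsUl 1?disjoint_sym //.
rewrite !exprD; ring.
Qed.

Lemma gmul1l : left_id gone gmul.
Proof.
move=> f; apply/ffunP => S; rewrite ffunE (bigD1 set0) ?sub0set //= ffunE eqxx.
rewrite setD0 inversions0s !mul1r big1 ?addr0 // => A /andP[_ /negbTE nA].
by rewrite ffunE nA mul0r mulr0.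
Qed.

Lemma gmul1r : right_id gone gmul.
Proof.
move=> f; apply/ffunP => S; rewrite ffunE (bigD1 S) //= ffunE setDv eqxx.
rewrite inversionss0 mul1r mulr1 big1 ?addr0 // => A /andP[sAS nA].
rewrite ffunE; case: eqP => [|_]; last by rewrite !mulr0.
by move/eqP; rewrite setD_eq0 => sSA; rewrite eqEsubset sAS sSA in nA.
Qed.

Lemma gmulDl : left_distributive gmul +%R.
Proof.
move=> f g h; apply/ffunP => S; rewrite !ffunE -big_split; apply: eq_bigr => A _.
by rewrite !ffunE mulrDl mulrDr.
Qed.

Lemma gmulDr : right_distributive gmul +%R.
Proof.
move=> f g h; apply/ffunP => S; rewrite !ffunE -big_split; apply: eq_bigr => A _.
by rewrite !ffunE !mulrDr.
Qed.

Lemma gone_neq0 : gone != 0.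
Proof.
apply/eqP => /ffunP/(_ set0); rewrite !ffunE eqxx => /eqP.
by rewrite (negbTE (oner_neq0 K)).
Qed.

HB.instance Definition _ := GRing.Zmodule_isNzRing.Build G
  gmulA gmul1l gmul1r gmulDl gmulDr gone_neq0.

Lemma gscaleAl (k : K) f g : k *: (f * g) = (k *: f) * g.
Proof.
apply/ffunP => S; rewrite !ffunE scaler_sumr; apply: eq_bigr => A _.
by rewrite !ffunE /GRing.scale /=; ring.
Qed.
HB.instance Definition _ := GRing.Lmodule_isLalgebra.Build K G gscaleAl.

Lemma gscaleAr (k : K) f g : k *: (f * g) = f * (k *: g).
Proof.
apply/ffunP => S; rewrite !ffunE scaler_sumr; apply: eq_bigr => A _.
by rewrite !ffunE /GRing.scale /=; ring.
Qed.
HB.instance Definition _ := GRing.Lalgebra_isAlgebra.Build K G gscaleAr.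

Lemma gmulE f g S : (f * g) S = \sum_(A : {set 'I_d} | A \subset S)
     (-1) ^+ inversions A (S :\: A) * (f A * g (S :\: A)).
Proof. by rewrite ffunE. Qed.

Lemma goneE S : (1 : G) S = (S == set0)%:R.
Proof. by rewrite ffunE. Qed.

Definition homog (b : bool) : {pred G} :=
  [pred f : G | [forall S : {set 'I_d}, (odd #|S| == b) || (f S == 0)]].

Lemma homogP b f : reflect (forall S, odd #|S| != b -> f S = 0) (f \in homog b).
Proof.
apply: (iffP forallP) => [H S /negbTE nS|H S]; first by have := H S; rewrite nS => /eqP.
by case: eqVneq => //= /H ->.
Qed.

Lemma homog_submod b : submod_closed (homog b).
Proof.
split=> [|k f g /homogP hf /homogP hg]; apply/homogP => S nS; rewrite !ffunE //.
by rewrite hf // hg // scaler0 addr0.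
Qed.
HB.instance Definition _ b := GRing.isSubmodClosed.Build K G (homog b) (homog_submod b).

Lemma homogM a b f g : f \in homog a -> g \in homog b -> f * g \in homog (a (+) b).
Proof.
move=> /homogP hf /homogP hg; apply/homogP => S nS; rewrite gmulE big1 // => A sAS.
have cS : #|S| = (#|A| + #|S :\: A|)%N.
  by rewrite -(cardsID A S); congr (#|pred_of_set _| + _)%N; apply/setIidPr.
case: (eqVneq (odd #|A|) a) => [eA|/hf ->]; last by rewrite mul0r mulr0.
by rewrite hg ?mulr0 //; move: nS; rewrite cS oddD eA; case: (a); case: (b); case: (odd _).
Qed.

Lemma homog1 : 1 \in homog false.
Proof.
apply/homogP => S nS; rewrite goneE.
by case: (eqVneq S set0) nS => [->|//]; rewrite cards0.
Qed.

(** Replacing [A] by its complement in [S] swaps the factors; the two signs differ by the parity of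
    the product of the cardinalities. *)
Lemma homog_comm a b f g : f \in homog a -> g \in homog b ->
  f * g = (-1) ^+ (a && b) * (g * f).
Proof.
move=> /homogP hf /homogP hg.
have -> : (-1) ^+ (a && b) * (g * f) = (-1) ^+ (a && b) *: (g * f).
  by case: (a && b); rewrite ?expr1 ?expr0 ?mul1r ?scale1r // mulN1r scaleN1r.
apply/ffunP => S; rewrite [RHS]ffunE !gmulE.
rewrite (reindex_onto (fun A => S :\: A) (fun A => S :\: A)) /=; last first.
  by move=> A sAS; rewrite setDDr setDv set0U; apply/setIidPr.
rewrite scaler_sumr; apply: eq_big => A.
  rewrite subsetDl /= setDDr setDv set0U.
  by apply/eqP/idP => [<-|/setIidPr //]; apply: subsetIl.
move=> /andP[_ /eqP eA]; rewrite eA /GRing.scale /=.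
case: (eqVneq (odd #|A|) b) => [oA|/hg ->]; last by rewrite !(mul0r, mulr0).
case: (eqVneq (odd #|S :\: A|) a) => [oB|/hf ->]; last by rewrite !(mul0r, mulr0).
rewrite [f _ * _]mulrC [RHS]mulrA; congr (_ * _).
have dA : [disjoint S :\: A & A] by rewrite disjoints_subset setDE subsetIr.
have /(congr1 odd) := inversions_sym dA; rewrite oddD oddM oA oB => eab.
by rewrite -eab signr_addb !signr_odd -mulrA -expr2 sqrr_sign mulr1.
Qed.

Definition gtheta (i : 'I_d) : G := [ffun S : {set 'I_d} => (S == [set i])%:R].

Lemma gtheta_homog i : gtheta i \in homog true.
Proof.
apply/homogP => S nS; rewrite ffunE.
by case: (eqVneq S [set i]) nS => [->|//]; rewrite cards1.
Qed.

Lemma gthetaC i j : gtheta i * gtheta j = - (gtheta j * gtheta i).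
Proof. by rewrite (homog_comm (gtheta_homog i) (gtheta_homog j)) expr1 mulN1r. Qed.

Lemma gthetaK i : gtheta i * gtheta i = 0.
Proof.
apply/ffunP => S; rewrite gmulE ffunE big1 // => A sAS; rewrite !ffunE.
case: eqP => [->|_]; last by rewrite mul0r mulr0.
case: eqP => [/setP/(_ i)|_]; last by rewrite !mulr0.
by rewrite !inE eqxx.
Qed.

Definition gtop : G -> K := fun f => f [set: 'I_d].

Lemma gtop_linear : linear_for *%R gtop.
Proof. by move=> k f g; rewrite /gtop !ffunE. Qed.
HB.instance Definition _ := GRing.isLinear.Build K G K *%R gtop gtop_linear.

(** Initial segments make the induction work: the new generator has the largest index, so it creates
    no inversion. *)
Lemma gprod_prefix k (le_kd : (k <= d)%N) :
  \prod_(i < k) gtheta (widen_ord le_kd i) =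
    [ffun S : {set 'I_d} => (S == [set i : 'I_d | (i < k)%N])%:R].
Proof.
elim: k le_kd => [|k IH] le_kd.
  rewrite big_ord0; apply/ffunP => S; rewrite [LHS]goneE [RHS]ffunE; congr (_ == _)%:R.
rewrite big_ord_recr /=.
have -> : \prod_(i < k) gtheta (widen_ord le_kd (widen_ord (leqnSn k) i)) =
  \prod_(i < k) gtheta (widen_ord (ltnW le_kd) i).
  by apply: eq_bigr => i _; congr gtheta; apply: val_inj.
rewrite IH; apply/ffunP => S; rewrite gmulE ffunE.
set P := [set i : 'I_d | (i < k)%N]; set x := widen_ord _ _.
have eP : [set i : 'I_d | (i < k.+1)%N] = x |: P.
  by apply/setP => i; rewrite !inE ltnS leq_eqVlt -val_eqE.
have xP : x \notin P by rewrite inE /= ltnn.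
rewrite eP; case: eqP => [->|nS].
  rewrite (bigD1 P) ?subsetUr //= !ffunE eqxx setDUl setDv setU0.
  have -> : [set x] :\: P = [set x] by apply/setDidPl; rewrite disjoints1.
  rewrite eqxx /inversions big1 ?mul1r ?big1 ?addr0 //; last first.
    by move=> i; rewrite inE => ik; rewrite big_set1 /=; lia.
  by move=> A /andP[_ /negbTE nA]; rewrite !ffunE nA mul0r mulr0.
rewrite big1 // => A sAS; rewrite !ffunE; case: eqP => [eA|]; last by rewrite mul0r mulr0.
case: eqP => [eD|]; last by rewrite !mulr0.
case: nS; rewrite -(setID S A) eD eA setUC; congr (_ :|: _).
by apply/setIidPr; rewrite -eA.
Qed.

Lemma gtop_theta : gtop (\prod_(i < d) gtheta i) = 1.
Proof.
have -> : \prod_(i < d) gtheta i = \prod_(i < d) gtheta (widen_ord (leqnn d) i).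
  by apply: eq_bigr => i _; congr gtheta; apply: val_inj.
rewrite gprod_prefix /gtop ffunE; case: eqP => // /setP H.
by exfalso; apply: H => i; rewrite !inE ltn_ord.
Qed.

End GrassmannRing.

(** * Products of anticommuting elements and forms *)

Section AnticommutingProducts.
Variable E : pzRingType.

Lemma prod_anticomm_front k (y : 'I_k.+1 -> E) (j : 'I_k.+1) :
  (forall i i', y i * y i' = - (y i' * y i)) ->
  y j * \prod_(i < k) y (lift j i) = (-1) ^+ j * \prod_i y i.
Proof.
elim: k y j => [|k IH] y j yC.
  by rewrite big_ord0 big_ord1 !ord1 mulr1 mul1r.
case: (unliftP ord0 j) => [j' ->|->]; last by rewrite mul1r [RHS]big_ord_recl.
rewrite big_ord_recl [in RHS]big_ord_recl mulrA.
have -> : lift (lift ord0 j') ord0 = ord0 :> 'I_k.+2 by apply: val_inj.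
rewrite yC mulNr -mulrA.
have -> : \prod_(i < k) y (lift (lift ord0 j') (lift ord0 i)) =
          \prod_(i < k) y (lift ord0 (lift j' i)).
  by apply: eq_bigr => i _; congr y; apply: val_inj; rewrite /= /bump /=; lia.
rewrite (IH (fun i => y (lift ord0 i))) //.
rewrite lift0 exprS mulN1r mulNr; congr (- _).
by rewrite !mulrA; congr (_ * _); apply: commr_sign.
Qed.

Lemma prod_anticomm_commute k (x : E) (y : 'I_k -> E) :
  (forall i, y i * x = - (x * y i)) ->
  \prod_i y i * x = (-1) ^+ k * (x * \prod_i y i).
Proof.
elim: k y => [|k IH] y yC; first by rewrite big_ord0 !mulr1 !mul1r.
rewrite big_ord_recl -mulrA IH // [LHS]mulrA (commr_sign (y ord0) k) -mulrA.
by rewrite [y ord0 * _]mulrA yC exprS mulN1r !mulNr mulrN -!mulrA.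
Qed.

Lemma prod_anticomm_back k (y : 'I_k.+1 -> E) (j : 'I_k.+1) :
  (forall i i', y i * y i' = - (y i' * y i)) ->
  \prod_(i < k) y (lift j i) * y j = (-1) ^+ (k + j) * \prod_i y i.
Proof.
by move=> yC; rewrite prod_anticomm_commute // prod_anticomm_front // mulrA exprD.
Qed.

(** A permutation is the value [s ord0] together with a permutation of the other indices, as in
    [lift_perm]; the sign splits accordingly. *)
Lemma prod_anticomm_perm k (y : 'I_k -> E) (s : 'S_k) :
  (forall i i', y i * y i' = - (y i' * y i)) ->
  \prod_i y (s i) = (-1) ^+ s * \prod_i y i.
Proof.
elim: k y s => [|k IH] y s yC.
  rewrite !big_ord0 mulr1; have -> : s = 1%g by apply/permP => -[].
  by rewrite odd_perm1.
have hu i : exists j, s (lift ord0 i) = lift (s ord0) j.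
  have : s ord0 != s (lift ord0 i) by rewrite (inj_eq perm_inj) neq_lift.
  by case/unlift_some => j -> _; exists j.
have [f hf] := fin_all_exists hu.
have f_inj : injective f.
  move=> i j eij; apply: (@lift_inj _ ord0); apply: (@perm_inj _ s).
  by rewrite !hf eij.
have es : s = lift_perm ord0 (s ord0) (perm f_inj).
  apply/permP => i; case: (unliftP ord0 i) => [j ->|->]; last by rewrite lift_perm_id.
  by rewrite lift_perm_lift permE hf.
rewrite big_ord_recl; rewrite (eq_bigr (fun i => y (lift (s ord0) (perm f_inj i)))); last first.
  by move=> i _; rewrite hf permE.
rewrite (IH (fun i => y (lift (s ord0) i))) // mulrA (commr_sign (y (s ord0)) _) -mulrA.
rewrite prod_anticomm_front // mulrA; congr (_ * _).
by rewrite [in RHS]es odd_lift_perm /= addbC signr_addb signr_odd.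
Qed.

Lemma prod_anticomm_eq0 k (y : 'I_k -> E) (i j : 'I_k) :
  (forall i i', y i * y i' = - (y i' * y i)) -> i != j -> y i * y j = 0 ->
  \prod_i y i = 0.
Proof.
case: k y i j => [|k] y i j; first by case: i.
move=> yC /unlift_some[j' ej _] yij.
apply: (can_inj (signrMK i)); rewrite mulr0 -prod_anticomm_front //.
case: k y i j j' yC ej yij => [|k] y i j j' yC ej yij; first by case: (j').
rewrite -[\prod_(_ < _) _](signrMK j') -(prod_anticomm_front (y := fun l => y (lift i l))) //.
by rewrite mulrA (commr_sign (y i) _) -mulrA [y i * _]mulrA -ej yij mul0r mulr0.
Qed.

Lemma prod_ord_ev_od n (F : 'I_n.*2 -> E) :
  \prod_i F i = \prod_(k < n) (F (ord_ev k) * F (ord_od k)).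
Proof.
elim: n F => [|n IH] F; first by rewrite !big_ord0.
rewrite !big_ord_recl -mulrA; congr (_ * _).
  by congr F; apply: val_inj.
congr (_ * _); first by congr F; apply: val_inj.
rewrite IH; apply: eq_bigr => k _.
by congr (F _ * F _); apply: val_inj; rewrite /= /bump /=; lia.
Qed.

End AnticommutingProducts.

(** * Forms as elements of the Grassmann algebra *)

Section GrassmannForms.
Variables (K : comNzRingType) (d : nat).
Notation G := (grass K d).

Lemma prod_gtheta_noninj k (f : {ffun 'I_k -> 'I_d}) :
  ~~ injectiveb f -> \prod_i gtheta K (f i) = 0.
Proof.
case/injectivePn => i [j nij eij]; apply: (@prod_anticomm_eq0 _ _ _ i j) => //.
- by move=> *; apply: gthetaC.
- by rewrite eij gthetaK.
Qed.

(* For [F f = H (v \o f)] with [H] alternating, this is [k!] times the element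
   representing [H] restricted to the vectors [v]. *)
Definition gext k (F : {ffun 'I_k -> 'I_d} -> K) : G :=
  \sum_f F f *: \prod_(i < k) gtheta K (f i).

Lemma eq_gext k (F H : {ffun 'I_k -> 'I_d} -> K) : F =1 H -> gext F = gext H.
Proof. by move=> e; apply: eq_bigr => f _; rewrite e. Qed.

Lemma gext_sum k (I : Type) (r : seq I) (P : pred I) (F : I -> {ffun 'I_k -> 'I_d} -> K) :
  gext (fun f => \sum_(i <- r | P i) F i f) = \sum_(i <- r | P i) gext (F i).
Proof.
by rewrite /gext exchange_big; apply: eq_bigr => f _; rewrite scaler_suml.
Qed.

Lemma gextZ k a (F : {ffun 'I_k -> 'I_d} -> K) :
  gext (fun f => a * F f) = a *: gext F.
Proof. by rewrite /gext scaler_sumr; apply: eq_bigr => f _; rewrite scalerA. Qed.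

(** A map on ['I_(h + k)] is a pair of maps, so arguments are concatenated without signs; the signed
    sum of [wedge] reappears through [gtop_gext]. *)
Lemma gext_mul h k (F : {ffun 'I_h -> 'I_d} -> K) (H : {ffun 'I_k -> 'I_d} -> K) :
  gext F * gext H =
  gext (fun f : {ffun 'I_(h + k) -> 'I_d} =>
    F [ffun i => f (lshift k i)] * H [ffun i => f (rshift h i)]).
Proof.
pose join (p : {ffun 'I_h -> 'I_d} * {ffun 'I_k -> 'I_d}) : {ffun 'I_(h + k) -> 'I_d} :=
  [ffun i => match split i with inl a => p.1 a | inr b => p.2 b end].
pose cut (f : {ffun 'I_(h + k) -> 'I_d}) :=
  ([ffun i => f (lshift k i)], [ffun i => f (rshift h i)]).
have joinl p i : join p (lshift k i) = p.1 i by rewrite ffunE (unsplitK (inl i)).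
have joinr p i : join p (rshift h i) = p.2 i by rewrite ffunE (unsplitK (inr i)).
have joinK : cancel join cut.
  by case=> f g; congr pair; apply/ffunP => i; rewrite ffunE ?joinl ?joinr.
have cutK : cancel cut join.
  move=> f; apply/ffunP => l; rewrite -[l]splitK.
  by case: (split l) => j /=; rewrite ?joinl ?joinr ffunE.
rewrite [in RHS]/gext (reindex join) /=; last first.
  by exists cut => f _; [apply: joinK | apply: cutK].
rewrite /gext big_distrlr pair_bigA; apply: eq_bigr => -[f g] _ /=.
rewrite -scalerAl -scalerAr scalerA big_split_ord /=; congr (_ * _ *: (_ * _)).
- by congr F; apply/ffunP => i; rewrite ffunE joinl.
- by congr H; apply/ffunP => i; rewrite ffunE joinr.
- by apply: eq_bigr => i _; rewrite joinl.
- by apply: eq_bigr => i _; rewrite joinr.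
Qed.

(** Reindexing [f] by the inverse of [s] moves the permutation to the generators, whose sign cancels
    [(-1) ^+ s]; all terms of the sum then coincide. *)
Lemma gext_alt k (F : {ffun 'I_k -> 'I_d} -> K) :
  gext (fun f => \sum_(s : 'S_k) (-1) ^+ s * F [ffun i => f (s i)]) = k`!%:R *: gext F.
Proof.
rewrite gext_sum.
transitivity (\sum_(s : 'S_k) gext F); last first.
  by rewrite sumr_const card_Sn scaler_nat.
apply: eq_bigr => s _; rewrite gextZ /gext.
rewrite (reindex_inj (h := fun f : {ffun 'I_k -> 'I_d} => [ffun i => f ((s^-1)%g i)])); last first.
  move=> f g /ffunP e; apply/ffunP => i; have := e (s i).
  by rewrite !ffunE permK.
rewrite scaler_sumr; apply: eq_bigr => f _; rewrite scalerA [_ * F _]mulrC -scalerA.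
congr (F _ *: _); first by apply/ffunP => i; rewrite !ffunE permK.
under eq_bigr do rewrite ffunE.
rewrite (prod_anticomm_perm (y := fun i => gtheta K (f i))); last by move=> *; apply: gthetaC.
by rewrite odd_permV scaler_sign mulr_sign; case: odd_perm; rewrite ?opprK.
Qed.

(** Repeated generators multiply to zero, so only permutations survive among the maps [f]. *)
Lemma gtop_gext (F : {ffun 'I_d -> 'I_d} -> K) :
  gtop (gext F) = \sum_(s : 'S_d) (-1) ^+ s * F [ffun i => s i].
Proof.
rewrite /gext linear_sum (bigID (fun f : {ffun 'I_d -> 'I_d} => injectiveb f)) /=.
rewrite [X in _ + X]big1 ?addr0 => [|f nf]; last by rewrite prod_gtheta_noninj // scaler0 linear0.
rewrite (reindex (fun s : 'S_d => pval s)) /=; last first.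
  (* The identity is merely the default value of [insubd]. *)
  have s0 : 'S_d by exact: 1%g.
  by exists (insubd s0) => /= f; rewrite ?valKd // => /(insubdK s0).
rewrite (eq_bigl predT) => [|s /=]; last by rewrite (valP s).
apply: eq_bigr => s _; rewrite linearZ /= pvalE.
rewrite (prod_anticomm_perm (y := fun i => gtheta K i)); last by move=> *; apply: gthetaC.
rewrite [LHS]mulrC; congr (_ * _); last first.
  by congr F; apply/ffunP => i; rewrite ffunE pvalE.
by rewrite mulr_sign; case: odd_perm; rewrite ?[LHS]raddfN /= gtop_theta.
Qed.

Lemma prod_ord_pairs (E : algType K) (x : 'I_d -> E) n (c : 'I_n -> 'I_d -> 'I_d -> K) :
  \prod_(k < n) \sum_i \sum_j c k i j *: (x i * x j) =
  \sum_(f : {ffun 'I_n.*2 -> 'I_d})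
    (\prod_(k < n) c k (f (ord_ev k)) (f (ord_od k))) *: \prod_i x (f i).
Proof.
under eq_bigr do rewrite pair_bigA /=.
rewrite bigA_distr_bigA /=.
have hlt (i : 'I_n.*2) : (i./2 < n)%N by have := ltn_ord i; lia.
pose join (p : {ffun 'I_n -> 'I_d * 'I_d}) : {ffun 'I_n.*2 -> 'I_d} :=
  [ffun i : 'I_n.*2 => let q := p (Ordinal (hlt i)) in if odd i then q.2 else q.1].
pose cut (f : {ffun 'I_n.*2 -> 'I_d}) : {ffun 'I_n -> 'I_d * 'I_d} :=
  [ffun k => (f (ord_ev k), f (ord_od k))].
have join_ev p k : join p (ord_ev k) = (p k).1.
  rewrite ffunE /= odd_double; congr (p _).1; apply: val_inj => /=; lia.
have join_od p k : join p (ord_od k) = (p k).2.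
  rewrite ffunE /= odd_double; congr (p _).2; apply: val_inj => /=; lia.
have joinK : cancel join cut.
  by move=> p; apply/ffunP => k; rewrite ffunE join_ev join_od; case: (p k).
have cutK : cancel cut join.
  move=> f; apply/ffunP => i; rewrite ffunE /= !ffunE /=.
  by case: ifP => oi; congr (f _); apply: val_inj => /=; lia.
rewrite [RHS](reindex join) /=; last by exists cut => f _; [apply: joinK | apply: cutK].
apply: eq_bigr => p _; rewrite prod_ord_ev_od -scaler_prod.
by apply: eq_bigr => k _; rewrite join_ev join_od.
Qed.
End GrassmannForms.

(** * Pfaffians over a commutative ring *)

Section EvenGrassmann.
Variables (K : comNzRingType) (d : nat).
Notation G := (grass K d).

Lemma homog_false_mulr_closed : mulr_closed (homog false : {pred G}).
Proof. by split=> [|f g hf hg]; [apply: homog1 | apply: (homogM hf hg)]. Qed.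
HB.instance Definition _ :=
  GRing.isMulClosed.Build G (homog false : {pred G}) homog_false_mulr_closed.

Record geven := GEven { geven_val :> G; geven_valP : geven_val \in (homog false : {pred G}) }.
HB.instance Definition _ := [isSub for geven_val].
HB.instance Definition _ := [Choice of geven by <:].
HB.instance Definition _ := [SubChoice_isSubAlgebra of geven by <:].

Lemma geven_mulC : commutative (@GRing.mul geven).
Proof.
move=> f g; apply: val_inj; rewrite !rmorphM /=.
by rewrite (homog_comm (geven_valP f) (geven_valP g)) mul1r.
Qed.
HB.instance Definition _ := GRing.PzRing_hasCommutativeMul.Build geven geven_mulC.


Lemma tt_even (i j : 'I_d) : gtheta K i * gtheta K j \in (homog false : {pred G}).
Proof. exact: (homogM (gtheta_homog K i) (gtheta_homog K j)). Qed.
Definition gtt i j : geven := GEven (tt_even i j).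

(** The 2-form attached to [Y]; it depends only on [Y - Y^T]. *)
Definition gform (Y : 'M[K]_d) : geven := \sum_i \sum_j Y i j *: gtt i j.

Lemma gform_linear : linear gform.
Proof.
move=> a Y Z; rewrite /gform scaler_sumr -big_split; apply: eq_bigr => i _ /=.
rewrite scaler_sumr -big_split; apply: eq_bigr => j _ /=.
by rewrite !mxE scalerDl scalerA.
Qed.
HB.instance Definition _ :=
  GRing.isLinear.Build K 'M[K]_d geven *:%R gform gform_linear.

Lemma gttC i j : gtt i j = - gtt j i.
Proof. by apply: val_inj; rewrite [RHS]raddfN /= gthetaC. Qed.

Lemma gform_tr Y : gform Y^T = - gform Y.
Proof.
rewrite /gform exchange_big -sumrN; apply: eq_bigr => i _ /=.
by rewrite -sumrN; apply: eq_bigr => j _; rewrite mxE gttC scalerN.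
Qed.

Lemma gform_delta i j : gform (delta_mx i j) = gtt i j.
Proof.
rewrite /gform (bigD1 i) //= (bigD1 j) //= mxE !eqxx scale1r !big1 ?addr0 //.
  by move=> k /negbTE nk; rewrite big1 // => l _; rewrite mxE nk scale0r.
by move=> l /negbTE nl; rewrite mxE nl andbF scale0r.
Qed.

Lemma val_gform Y :
  val (gform Y) = \sum_i \sum_j Y i j *: (gtheta K i * gtheta K j) :> G.
Proof.
rewrite /gform raddf_sum; apply: eq_bigr => i _; rewrite raddf_sum.
by apply: eq_bigr => j _; rewrite [LHS]linearZ.
Qed.

Lemma gtop_prod_gtheta (C : 'M[K]_d) :
  gtop (\prod_i \sum_j C j i *: gtheta K j) = \det C.
Proof.
rewrite bigA_distr_bigA /=.
have -> : \sum_(f : {ffun 'I_d -> 'I_d}) \prod_i (C (f i) i *: gtheta K (f i)) =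
          gext (fun f : {ffun 'I_d -> 'I_d} => \prod_i C (f i) i).
  by apply: eq_bigr => f _; rewrite scaler_prod.
rewrite gtop_gext -det_tr; apply: eq_bigr => s _; congr (_ * _).
by apply: eq_bigr => i _; rewrite ffunE mxE.
Qed.

End EvenGrassmann.

(** * Pfaffians as top coefficients *)

Section Pfaffians.
Variable n : nat.
Notation m := n.*2.

(* On a constant family this is [2 ^ n * n`!] times the Pfaffian. *)
Definition pf (K : comNzRingType) (Y : 'I_n -> 'M[K]_m) : K :=
  \sum_(s : 'S_m) (-1) ^+ s * \prod_(k < n) Y k (s (ord_ev k)) (s (ord_od k)).

Lemma eq_pf (K : comNzRingType) (Y Z : 'I_n -> 'M[K]_m) : Y =1 Z -> pf Y = pf Z.
Proof.
by move=> e; apply: eq_bigr => s _; congr (_ * _); apply: eq_bigr => k _; rewrite e.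
Qed.

Lemma rmorph_pf (K L : comNzRingType) (phi : {rmorphism K -> L}) Y :
  phi (pf Y) = pf (fun k => map_mx phi (Y k)).
Proof.
rewrite rmorph_sum; apply: eq_bigr => s _; rewrite rmorphM rmorph_sign rmorph_prod.
by congr (_ * _); apply: eq_bigr => k _; rewrite mxE.
Qed.

Section OneRing.
Variable K : comNzRingType.
Notation M := 'M[K]_m.

(** The Pfaffian as a Berezin integral: the sum over permutations becomes a product of commuting
    2-forms. *)
Lemma pf_gtop (Y : 'I_n -> M) : pf Y = gtop (val (\prod_k gform (Y k)) : grass K m).
Proof.
rewrite rmorph_prod /=; under eq_bigr do rewrite val_gform.
rewrite prod_ord_pairs.
rewrite [X in gtop X](_ : _ = gext (fun f : {ffun 'I_m -> 'I_m} =>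
  \prod_(k < n) Y k (f (ord_ev k)) (f (ord_od k)))) //.
rewrite gtop_gext; apply: eq_bigr => s _; congr (_ * _).
by apply: eq_bigr => k _; rewrite !ffunE.
Qed.

(* The polarized [pf] at [(Z, A, ..., A)], see [pf_pfder]. *)
Definition pfder (A Z : M) : K :=
  gtop (val (gform Z * gform A ^+ n.-1) : grass K m).

Lemma pfder_linear A : linear_for *%R (pfder A).
Proof.
move=> a Y Z; rewrite /pfder linearP mulrDl -scalerAl.
by rewrite !linearD !linearZ.
Qed.
HB.instance Definition _ A :=
  GRing.isLinear.Build K M K *%R (pfder A) (pfder_linear A).

Lemma pfder_tr A Z : pfder A Z^T = - pfder A Z.
Proof. by rewrite /pfder gform_tr mulNr !raddfN. Qed.

Lemma pf_pfder (A Z : M) (k0 : 'I_n) :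
  pf (fun k => if k == k0 then Z else A) = pfder A Z.
Proof.
rewrite pf_gtop (bigD1 k0) //= eqxx /pfder.
rewrite (eq_bigr (fun=> gform A)) => [|k /negbTE -> //].
by rewrite prodr_const cardC1 card_ord.
Qed.

(** Congruence by [h] substitutes [\sum_i h i a *: gtheta K i] for the generator of index [a]. Each
    monomial then has as top coefficient the determinant of [h] times a selection matrix, so
    [\det h] factors out. *)
Lemma pf_congr (g : M) (Y : 'I_n -> M) :
  pf (fun k => g *m Y k *m g^T) = \det g * pf Y.
Proof.
have H (h : M) : pf (fun k => h *m Y k *m h^T) = \det h *
    \sum_(f : {ffun 'I_m -> 'I_m}) (\prod_k Y k (f (ord_ev k)) (f (ord_od k))) *
      \det (\matrix_(i, j) (i == f j)%:R).
  rewrite pf_gtop rmorph_prod /=.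
  have e k : val (gform (h *m Y k *m h^T)) = \sum_a \sum_b Y k a b *:
      ((\sum_i h i a *: gtheta K i) * (\sum_j h j b *: gtheta K j)) :> grass K m.
    rewrite val_gform.
    pose t (p q : 'I_m * 'I_m) : grass K m :=
      (h p.1 q.1 * Y k q.1 q.2 * h p.2 q.2) *: (gtheta K p.1 * gtheta K p.2).
    transitivity (\sum_p \sum_q t p q).
      rewrite pair_bigA; apply: eq_bigr => p _ /=.
      rewrite mxE scaler_suml -(pair_bigA _ (fun a b => t p (a, b))) exchange_big /=.
      apply: eq_bigr => b _; rewrite !mxE mulr_suml scaler_suml.
      by apply: eq_bigr => a _.
    rewrite exchange_big [RHS]pair_bigA; apply: eq_bigr => q _ /=.
    rewrite big_distrlr pair_bigA scaler_sumr; apply: eq_bigr => p _ /=.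
    rewrite -scalerAl -scalerAr !scalerA; congr (_ *: _).
    by rewrite [h p.1 q.1 * _]mulrC.
  under eq_bigr do rewrite e.
  rewrite prod_ord_pairs raddf_sum mulr_sumr; apply: eq_bigr => f _ /=.
  rewrite linearZ /= mulrCA; congr (_ * _).
  rewrite -det_mulmx -gtop_prod_gtheta; congr gtop; apply: eq_bigr => i _.
  apply: eq_bigr => j _; congr (_ *: _); rewrite mxE (bigD1 (f i)) //= mxE eqxx mulr1.
  by rewrite big1 ?addr0 // => l /negbTE nl; rewrite mxE nl mulr0.
rewrite H; congr (_ * _); have := H 1%:M; rewrite det1 mul1r => <-.
by apply: eq_pf => k; rewrite trmx1 mul1mx mulmx1.
Qed.

End OneRing.
End Pfaffians.

(** * The Pfaffian adjugate and the adjugate *)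

Section PolynomialDerivatives.
Variable R : comNzRingType.

Lemma deriv_prod_ord k (F : 'I_k -> {poly R}) :
  (\prod_i F i)^`() = \sum_i \prod_j (if j == i then (F j)^`() else F j).
Proof.
elim: k F => [|k IH] F; first by rewrite !big_ord0 derivC.
rewrite big_ord_recl derivM IH [RHS]big_ord_recl; congr (_ + _).
  by rewrite [RHS]big_ord_recl.
rewrite mulr_sumr; apply: eq_bigr => i _; rewrite [RHS]big_ord_recl /=.
by congr (_ * _); apply: eq_bigr => j _; rewrite (inj_eq (@lift_inj _ ord0)).
Qed.

(** Jacobi's formula: differentiate one row at a time, then expand along that row, whose cofactors
    are those of [M]. *)
Lemma deriv_det k (M : 'M[{poly R}]_k) :
  (\det M)^`() = \tr (map_mx (@deriv R) M *m \adj M).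
Proof.
pose N i : 'M[{poly R}]_k := \matrix_(a, b) if a == i then (M a b)^`() else M a b.
transitivity (\sum_i \det (N i)).
  rewrite /determinant raddf_sum exchange_big; apply: eq_bigr => s _ /=.
  rewrite !mulr_sign -mulr_sumr mulr_sign; case: odd_perm; rewrite ?derivN deriv_prod_ord.
    congr (- _); apply: eq_bigr => i _.
    by apply: eq_bigr => j _; rewrite mxE.
  by apply: eq_bigr => i _; apply: eq_bigr => j _; rewrite mxE.
apply: eq_bigr => i _; rewrite mxE (expand_det_row _ i); apply: eq_bigr => j _.
rewrite !mxE eqxx; congr (_ * _); rewrite /cofactor; congr (_ * \det _).
apply/matrixP => a b; rewrite !mxE.
by rewrite eq_sym (negbTE (neq_lift _ _)).
Qed.

Lemma deriv_pf n (A : 'M[{poly R}]_n.*2) :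
  (pf (fun=> A))^`() = pfder A (map_mx (@deriv R) A) *+ n.
Proof.
transitivity (\sum_(i < n) pf (fun k => if k == i then map_mx (@deriv R) A else A)).
  rewrite /pf raddf_sum exchange_big; apply: eq_bigr => s _ /=.
  rewrite !mulr_sign -mulr_sumr mulr_sign; case: odd_perm; rewrite ?derivN deriv_prod_ord.
    congr (- _); apply: eq_bigr => i _.
    by apply: eq_bigr => j _; case: ifP; rewrite ?mxE.
  by apply: eq_bigr => i _; apply: eq_bigr => j _; case: ifP; rewrite ?mxE.
under eq_bigr do rewrite pf_pfder.
by rewrite sumr_const card_ord.
Qed.

Definition regular (a : R) := forall x, a * x = 0 -> x = 0.

Lemma polyM_regular0 (p r : {poly R}) : regular p`_0 -> p * r = 0 -> r = 0.
Proof.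
move=> rp e; apply/polyP => k; rewrite coef0.
elim/ltn_ind: k => k IH; apply: rp.
have := congr1 (fun q : {poly R} => q`_k) e; rewrite coef0 coefM big_ord_recl /= subn0.
rewrite big1 ?addr0 // => i _; rewrite IH ?mulr0 //.
by rewrite /bump /=; have := ltn_ord i; lia.
Qed.

(** Once the coefficients of [r] up to degree [k] vanish, the equation in degree [k] says that the
    constant term of [p] times [k.+1] times the next coefficient is zero; both factors can be
    removed without division. *)
Lemma poly_ode_unique (a : nat) (p r : {poly R}) :
  (forall k (x : R), x *+ k.+1 = 0 -> x = 0) -> regular p`_0 ->
  r`_0 = 0 -> p * r^`() = p^`() * r *+ a -> r = 0.
Proof.
move=> tf rp r0 e; apply/polyP => k; rewrite coef0.
elim/ltn_ind: k => -[|k] IH //; apply: (tf k); apply: rp.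
have := congr1 (fun q : {poly R} => q`_k) e; rewrite coefMn !coefM.
rewrite big_ord_recl /= subn0 coef_deriv big1 => [|i _]; last first.
  rewrite coef_deriv IH ?mul0rn ?mulr0 //.
  by rewrite /bump /=; have := ltn_ord i; lia.
rewrite addr0 big1 ?mul0rn // => i _.
by rewrite IH ?mulr0 //; lia.
Qed.

End PolynomialDerivatives.

(** * The gradient of the Pfaffian *)

Section PfaffianAdjugate.
Variable n : nat.
Notation m := n.+1.*2.

Lemma rmorph_pfder (R S : comNzRingType) (phi : {rmorphism R -> S}) (A Z : 'M[R]_m) :
  phi (pfder A Z) = pfder (map_mx phi A) (map_mx phi Z).
Proof.
rewrite -!(pf_pfder _ _ ord0) rmorph_pf; apply: eq_pf => k.
by case: ifP.
Qed.

(* Differentiate [pf_congr] at [g = 1] in the direction [C]. *)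
Lemma pfder_mull (R : comNzRingType) (A C : 'M[R]_m) : A^T = - A ->
  pfder A (C *m A) *+ m = \tr C * pf (fun=> A).
Proof.
move=> skA; pose ev0 : {rmorphism {poly R} -> R} := horner_eval (0 : R).
have ev0E (p : {poly R}) : ev0 p = p.[0] by [].
pose A' := map_mx (@polyC R) A; pose C' := map_mx (@polyC R) C.
have mapT (S T : comNzRingType) (f : S -> T) (M : 'M[S]_m) :
  map_mx f M^T = (map_mx f M)^T by apply/matrixP => i j; rewrite !mxE.
pose g := 1%:M + 'X *: C'; pose B := g *m A' *m g^T.
have ev0C (M : 'M[R]_m) : map_mx ev0 (map_mx (@polyC R) M) = M.
  by apply/matrixP => i j; rewrite !mxE !ev0E hornerC.
have ev0g : map_mx ev0 g = 1%:M.
  apply/matrixP => i j; rewrite !mxE !ev0E !hornerE.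
  by case: (i == j); rewrite /= ?hornerE.
have ev0B : map_mx ev0 B = A.
  by rewrite !map_mxM mapT ev0g ev0C trmx1 mul1mx mulmx1.
have deriv0 (a : R) (b e : {poly R}) :
    ev0 (a%:P + 'X * b + 'X * 'X * e)^`() = ev0 b.
  rewrite !derivD !derivM derivX derivC !ev0E !hornerE /=.
  by rewrite !(mul0r, mulr0, addr0, add0r, mul1r).
have dg : map_mx ev0 (map_mx (@deriv R) g) = C.
  apply/matrixP => i j; rewrite !mxE.
  have -> : (i == j)%:R + 'X * (C i j)%:P = (i == j)%:R%:P + 'X * (C i j)%:P + 'X * 'X * 0.
    by rewrite mulr0 addr0 polyC_natr.
  by rewrite deriv0 !ev0E hornerC.
have dB : map_mx ev0 (map_mx (@deriv R) B) = C *m A + A *m C^T.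
  have -> : B = A' + 'X *: (C' *m A' + A' *m C'^T) + ('X * 'X) *: (C' *m A' *m C'^T).
    rewrite /B /g linearD linearZ /= trmx1 !mulmxDl !mulmxDr !mul1mx !mulmx1.
    rewrite -!(scalemxAl, scalemxAr) scalerA scalerDr.
    by rewrite !addrA; congr (_ + _); rewrite addrAC.
  have e : C' *m A' + A' *m C'^T = map_mx (@polyC R) (C *m A + A *m C^T).
    by rewrite map_mxD !map_mxM mapT.
  rewrite e; apply/matrixP => i j; rewrite !mxE.
  by rewrite deriv0 !ev0E hornerC.
have := congr1 ev0 (congr1 (@deriv R) (pf_congr g (fun=> A'))).
rewrite (deriv_pf B) derivM rmorphMn /= rmorph_pfder ev0B dB.
rewrite -(rmorph_pf (@polyC R) (fun=> A)) derivC mulr0 addr0 rmorphM deriv_det.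
rewrite -trace_map_mx map_mxM dg map_mx_adj ev0g adj1 mulmx1.
rewrite !ev0E hornerC => <-.
rewrite linearD /=.
(* By skewness both halves of the derivative contribute equally, which turns [n.+1] into [m]. *)
have -> : A *m C^T = - (C *m A)^T by rewrite trmx_mul skA mulNmx opprK.
by rewrite raddfN /= pfder_tr opprK -mulr2n -mulrnA mul2n.
Qed.

(** For skew [A] the entries are, up to sign and a common integer factor, the Pfaffians of [A] with
    rows and columns [i] and [j] removed. *)
Definition pfadj (R : comNzRingType) (A : 'M[R]_m) : 'M[R]_m :=
  \matrix_(i, j) pfder A (delta_mx i j).

(** The Pfaffian analogue of [mul_mx_adj]: each entry is [pfder_mull] at a matrix unit, whose trace
    is a Kronecker symbol. *)
Lemma mul_pfadj (R : comNzRingType) (A : 'M[R]_m) : A^T = - A ->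
  A *m (pfadj A)^T *+ m = (pf (fun=> A))%:M.
Proof.
move=> skA; apply/matrixP => a b; rewrite mulmxnE mxE.
have -> : \sum_j A a j * (pfadj A)^T j b = pfder A (delta_mx b a *m A).
  have -> : delta_mx b a *m A = \sum_j A a j *: delta_mx b j.
    apply/matrixP => i j; rewrite summxE mxE.
    rewrite (eq_bigr (fun k => ((i == b) && (k == a))%:R * A k j)) => [|k _]; last first.
      by rewrite mxE.
    rewrite (bigD1 a) //= eqxx andbT big1 ?addr0 => [|k /negbTE ->]; last first.
      by rewrite andbF mul0r.
    rewrite (eq_bigr (fun k => A a k * ((i == b) && (j == k))%:R)) => [|k _]; last first.
      by rewrite !mxE.
    rewrite (bigD1 j) //= eqxx andbT mulrC big1 ?addr0 // => k nk.
    by rewrite [j == k]eq_sym (negbTE nk) andbF mulr0.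
  rewrite linear_sum; apply: eq_bigr => j _ /=.
  by rewrite linearZ !mxE.
rewrite pfder_mull // mxE -mulr_natl; congr (_ * _).
rewrite /mxtrace (bigD1 b) //= mxE eqxx /= big1 ?addr0 1?eq_sym // => i /negbTE ni.
by rewrite mxE ni.
Qed.

Lemma rmorph_pfadj (R S : comNzRingType) (phi : {rmorphism R -> S}) (A : 'M[R]_m) :
  map_mx phi (pfadj A) = pfadj (map_mx phi A).
Proof.
apply/matrixP => i j; rewrite !mxE rmorph_pfder; congr (pfder _ _).
by apply/matrixP => a b; rewrite !mxE rmorph_nat.
Qed.

Lemma pfadj_skew (R : comNzRingType) (A : 'M[R]_m) : (pfadj A)^T = - pfadj A.
Proof. by apply/matrixP => i j; rewrite !mxE -pfder_tr trmx_delta. Qed.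

(* On the segment from [J] to [A] the polynomials [p = pf] and [q = det] satisfy
   [p q' = 2 p' q], an equation also solved by [p ^ 2]; hence [q] is a constant
   multiple of [p ^ 2], and [p] can be cancelled since its constant term is
   regular. *)
Lemma pfadj_adj (R : comNzRingType) (A J : 'M[R]_m) :
  (forall k (x : R), x *+ k.+1 = 0 -> x = 0) ->
  A^T = - A -> J^T = - J -> regular (pf (fun=> J)) ->
  pf (fun=> J) ^+ 2 *: \adj A = - (\det J * pf (fun=> A) *: pfadj A) *+ m.
Proof.
move=> tf skA skJ rJ.
pose Z := map_mx (@polyC R) (A - J); pose B := map_mx (@polyC R) J + 'X *: Z.
have mapT (M : 'M[R]_m) : (map_mx (@polyC R) M)^T = map_mx (@polyC R) M^T.
  by apply/matrixP => i j; rewrite !mxE.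
have skB : B^T = - B.
  rewrite /B /Z linearD linearZ /= !mapT linearB /= skA skJ.
  by apply/matrixP => i j; rewrite !mxE; rewrite !(rmorphB, rmorphN); ring.
have evB x : map_mx (horner_eval x) B = J + x *: (A - J).
  by apply/matrixP => i j; rewrite !mxE /horner_eval !hornerE.
have dB : map_mx (@deriv R) B = Z.
  apply/matrixP => i j; have ZE : Z i j = ((A - J) i j)%:P by rewrite mxE.
  have BE : B i j = (J i j)%:P + 'X * Z i j by rewrite !mxE.
  by rewrite [LHS]mxE BE ZE derivD derivM derivX !derivC mul1r mulr0 addr0 add0r.
set p := pf (fun=> B); set q := \det B.
have evp x : p.[x] = pf (fun=> J + x *: (A - J)).
  by have := rmorph_pf (horner_eval x) (fun=> B); rewrite evB.
have evq x : q.[x] = \det (J + x *: (A - J)).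
  by have := det_map_mx (horner_eval x) B; rewrite evB => ->.
have p0 : p`_0 = pf (fun=> J) by rewrite -horner_coef0 evp scale0r addr0.
have q0 : q`_0 = \det J by rewrite -horner_coef0 evq scale0r addr0.
(* Use [pfder_mull] with [C := Z *m \adj B]: its trace is the derivative of [q], and [C *m B] is
   [q *: Z]. *)
have ode : p * q^`() = p^`() * q *+ 2.
  rewrite deriv_det dB mulrC -(pfder_mull _ skB) -mulmxA mul_adj_mx mul_mx_scalar.
  by rewrite linearZ /= deriv_pf dB !mulrnAl -mulrnA muln2 mulrC.
have pq : (q * (p`_0 ^+ 2)%:P) = (q`_0)%:P * p ^+ 2.
  apply/eqP; rewrite -subr_eq0; apply/eqP.
  apply: (poly_ode_unique (a := 2) (p := p)) => //; first by rewrite p0.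
    by rewrite coefB coefMC coefCM expr2 coef0M -expr2 subrr.
  rewrite (expr2 p) derivB !derivM !derivC.
  transitivity ((p * q^`()) * (p`_0 ^+ 2)%:P -
    p * ((q`_0)%:P * (p^`() * p + p * p^`()))); first by ring.
  by rewrite ode; ring.
apply/matrixP => i j.
have := congr1 (fun M => (\adj B *m M) i j) (mul_pfadj skB).
rewrite -/p -scaler_nat -scalemxAr mulmxA mul_adj_mx mul_scalar_mx mul_mx_scalar -/q.
rewrite 3![in LHS]mxE [in RHS]mxE; set x := pfadj B j i => e.
have {}e : (p`_0 ^+ 2)%:P * \adj B i j = m%:R * ((q`_0)%:P * p * x).
  apply/eqP; rewrite -subr_eq0; apply/eqP; apply: (polyM_regular0 (p := p)).
    by rewrite p0.
  rewrite mulrBr mulrCA -e.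
  transitivity (m%:R * x * (q * (p`_0 ^+ 2)%:P) - p * (m%:R * ((q`_0)%:P * p * x))).
    by ring.
  by rewrite pq; ring.
(* Only after [p] has been cancelled is the variable set to 1, where [B] becomes [A]. *)
have := congr1 (horner_eval 1) e; rewrite -polyC_natr /horner_eval !hornerM !hornerC.
have evB1 : map_mx (horner_eval 1) B = A by rewrite evB scale1r addrC subrK.
have -> : (\adj B i j).[1] = \adj A i j.
  have := map_mx_adj (horner_eval (1 : R)) B.
  by rewrite evB1 => <-; rewrite [RHS]mxE.
have -> : x.[1] = - pfadj A i j.
  have -> : - pfadj A i j = (pfadj A)^T i j by rewrite pfadj_skew [RHS]mxE.
  have := rmorph_pfadj (horner_eval (1 : R)) B; rewrite evB1 => <-.
  by rewrite [RHS]mxE [RHS]mxE.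
have -> : p.[1] = pf (fun=> A) by rewrite evp scale1r addrC subrK.
rewrite p0 q0 => e1; rewrite [LHS]mxE e1 mulr_natl mulrN mulmxnE; congr (_ *+ _).
by rewrite [RHS]mxE [in RHS]mxE.
Qed.



(** The standard symplectic matrix, starting point of the path: its Pfaffian is a positive integer,
    hence regular over a torsion-free ring. *)
Definition stdJ (R : comNzRingType) : 'M[R]_m :=
  \sum_(k < n.+1) (delta_mx (ord_ev k) (ord_od k) - delta_mx (ord_od k) (ord_ev k)).

Lemma stdJ_skew R : (stdJ R)^T = - stdJ R.
Proof.
rewrite /stdJ linear_sum -sumrN; apply: eq_bigr => k _.
by rewrite linearB /= !trmx_delta opprB.
Qed.

Lemma rmorph_stdJ (R S : comNzRingType) (phi : {rmorphism R -> S}) :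
  map_mx phi (stdJ R) = stdJ S.
Proof.
rewrite /stdJ raddf_sum; apply: eq_bigr => k _.
by rewrite raddfB /= !map_delta_mx.
Qed.

Lemma expr_sum_sq0 (R : comNzRingType) k (z : 'I_k -> R) :
  (forall i, z i * z i = 0) -> (\sum_i z i) ^+ k = (\prod_i z i) *+ k`!.
Proof.
move=> z2.
have -> : (\sum_i z i) ^+ k = \prod_(j < k) \sum_i z i by rewrite prodr_const card_ord.
rewrite bigA_distr_bigA (bigID (fun f : {ffun 'I_k -> 'I_k} => injectiveb f)) /=.
rewrite [X in _ + X]big1 ?addr0 => [|f /injectivePn[i [j nij eij]]]; last first.
  by rewrite (bigD1 i) //= (bigD1 j) 1?eq_sym //= eij mulrA z2 mul0r.
rewrite (reindex (fun s : 'S_k => pval s)) /=; last first.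
  have s0 : 'S_k by exact: 1%g.
  by exists (insubd s0) => /= f; rewrite ?valKd // => /(insubdK s0).
rewrite (eq_bigl predT) => [|s /=]; last by rewrite (valP s).
rewrite -card_Sn -sumr_const; apply: eq_bigr => s _.
by rewrite [RHS](reindex_inj (@perm_inj _ s)); apply: eq_bigr => i _; rewrite pvalE.
Qed.

(** The 2-form of [stdJ] is twice a sum of commuting elements of square zero, so its top power
    counts their orderings. *)
Lemma pf_stdJ (R : comNzRingType) : pf (fun=> stdJ R) = (2 ^ n.+1 * n.+1`!)%:R.
Proof.
rewrite pf_gtop prodr_const card_ord /stdJ linear_sum.
have -> : \sum_(k < n.+1) gform (delta_mx (ord_ev k) (ord_od k) - delta_mx (ord_od k) (ord_ev k)) =
   (\sum_(k < n.+1) gtt R (ord_ev k) (ord_od k)) *+ 2.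
  rewrite -sumrMnl; apply: eq_bigr => k _.
  by rewrite linearB /= !gform_delta [X in _ - X]gttC opprK mulr2n.
rewrite exprMn_n expr_sum_sq0; last first.
  move=> k; apply: val_inj; rewrite rmorphM rmorph0 /=.
  rewrite mulrA -(mulrA _ (gtheta R (ord_od k))) gthetaC mulrN mulNr mulrA gthetaK.
  by rewrite !mul0r oppr0.
have t : gtop (val (\prod_(k < n.+1) gtt R (ord_ev k) (ord_od k)) : grass R m) = 1.
  by rewrite rmorph_prod /= -(prod_ord_ev_od (fun i => gtheta R i)) gtop_theta.
by rewrite -mulrnA mulnC !raddfMn; congr (_ *+ _).
Qed.

End PfaffianAdjugate.

(** * Adjugates of nilpotent matrices *)

Section Nilpotent.
Variables (R : comNzRingType) (k : nat).
Implicit Type A : 'M[R]_k.+1.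

Lemma adjN A : \adj (- A) = (-1) ^+ k *: \adj A.
Proof.
apply/matrixP => i j; rewrite !mxE /cofactor mulrCA; congr (_ * _).
have -> : row' j (col' i (- A)) = - 1 *: row' j (col' i A).
  by apply/matrixP => a b; rewrite !mxE mulN1r.
by rewrite detZ.
Qed.

(** Nilpotency truncates the geometric series for the inverse of ['X - A]; this takes the place of
    Newton's identities. *)
Lemma char_poly_mx_geom A N : A ^+ N = 0 ->
  char_poly_mx A *m (\sum_(i < N) 'X^(N.-1 - i) *: map_mx polyC (A ^+ i)) = ('X^N)%:M.
Proof.
move=> A0; pose x : 'M[{poly R}]_k.+1 := 'X%:M.
have xX j : x ^+ j = ('X^j)%:M by rewrite rmorphXn.
have cX : GRing.comm x (map_mx polyC A) by rewrite /GRing.comm -!mulmxE scalar_mxC.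
have := subrXX_comm N cX; rewrite -(rmorphXn (map_mx (@polyC R))) A0 rmorph0 subr0 xX => ->.
rewrite mulmxE; congr (_ * _); apply: eq_bigr => i _.
by rewrite xX -mulmxE mul_scalar_mx -(rmorphXn (map_mx (@polyC R))).
Qed.

(* Multiplying [char_poly_mx_geom] by the adjugate and taking traces gives
   ['X * P^`() = P *+ k.+1] for the characteristic polynomial [P]. *)
Lemma char_poly_nilp A N : (forall j (x : R), x *+ j.+1 = 0 -> x = 0) ->
  A ^+ N = 0 -> (forall j, \tr (A ^+ j.+1) = 0) -> char_poly A = 'X^(k.+1).
Proof.
move=> tf A0 trA; set P := char_poly A.
have N0 : (0 < N)%N.
  by case: N A0 => // /eqP; rewrite expr0 oner_eq0.
have dP : P^`() = \tr (\adj (char_poly_mx A)).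
  rewrite /P /char_poly deriv_det; congr (\tr _).
  have -> : map_mx (@deriv R) (char_poly_mx A) = 1%:M.
    apply/matrixP => i j; rewrite !mxE derivB derivC subr0.
    by case: (i == j); rewrite ?mulr0n ?mulr1n ?derivX ?deriv0.
  by rewrite mul1mx.
have XP : 'X * P^`() = P *+ k.+1.
  (* After multiplication by a power of ['X], only the term [i = 0] of the geometric sum has nonzero
     trace. *)
  apply: (monic_lreg (monicXn _ N.-1)); rewrite /= mulrA -exprSr (prednK N0).
  have /(congr1 (fun M => \tr (\adj (char_poly_mx A) *m M))) := char_poly_mx_geom A0.
  rewrite mulmxA mul_adj_mx -/(char_poly A) -/P mul_mx_scalar mul_scalar_mx.
  rewrite !linearZ /= -dP => <-; rewrite raddf_sum -[in LHS](prednK N0) big_ord_recl /=.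
  rewrite subn0 linearZ /= rmorph1 mxtrace1 big1 ?addr0 => [|i _]; last first.
    by rewrite linearZ /= trace_map_mx trA rmorph0 mulr0.
  by rewrite mulrCA mulr_natr.
have mP : P \is monic := char_poly_monic A.
have sP : size P = k.+2 := size_char_poly A.
apply/polyP => i; rewrite coefXn; case: ltngtP => ik; last first.
- by move: mP; rewrite monicE lead_coefE sP ik => /eqP.
- by rewrite nth_default // sP.
(* In degree [i] the equation says that [k.+1 - i] kills the coefficient of [P]. *)
apply: (tf (k - i)%N).
have := congr1 (fun q : {poly R} => q`_i) XP; rewrite coefXM coefMn coef_deriv.
have -> : (if i == 0%N then 0 else P`_i.-1.+1 *+ i.-1.+1) = P`_i *+ i.
  by case: i {ik}.
by move=> e; rewrite -subSn // mulrnBr 1?ltnW // e subrr.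
Qed.

(** Cayley-Hamilton lowers the nilpotency exponent to the size [k.+1]. Cancelling ['X^(k.+1)]
    identifies the adjugate of ['X - A] with the geometric sum, of which evaluation at 0 keeps the
    last term. *)
Lemma adj_nilp A N : (forall j (x : R), x *+ j.+1 = 0 -> x = 0) ->
  A ^+ N = 0 -> (forall j, \tr (A ^+ j.+1) = 0) -> \adj A = (-1) ^+ k *: A ^+ k.
Proof.
move=> tf A0 trA; have eP := char_poly_nilp tf A0 trA.
have Ak : A ^+ k.+1 = 0.
  by have := Cayley_Hamilton A; rewrite eP rmorphXn /= horner_mx_X.
have e : \adj (char_poly_mx A) =
   \sum_(i < k.+1) 'X^(k - i) *: map_mx polyC (A ^+ i).
  have /(congr1 (mulmx (\adj (char_poly_mx A)))) := char_poly_mx_geom Ak.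
  rewrite mulmxA mul_adj_mx -/(char_poly A) eP mul_mx_scalar mul_scalar_mx => e.
  apply/matrixP => i j; have /matrixP/(_ i j) := e; rewrite [LHS]mxE [RHS]mxE.
  by move/(monic_lreg (monicXn _ _)).
have ev (M : 'M[R]_k.+1) j : map_mx (horner_eval 0) ('X^j *: map_mx polyC M) = 0 ^+ j *: M.
  by apply/matrixP => a b; rewrite !mxE /horner_eval !hornerE.
have := congr1 (map_mx (horner_eval (0 : R))) e.
rewrite map_mx_adj.
have -> : map_mx (horner_eval 0) (char_poly_mx A) = - A.
  by apply/matrixP => i j; rewrite !mxE /horner_eval !hornerE hornerMn hornerX mul0rn sub0r.
rewrite adjN raddf_sum big_ord_recr /= subnn ev expr0 scale1r big1 ?add0r => [|i _]; last first.
  by rewrite ev expr0n subn_eq0 leqNgt ltn_ord scale0r.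
by move=> <-; rewrite scalerA -expr2 sqrr_sign scale1r.
Qed.

End Nilpotent.

(** * The generic symmetric matrix *)

Section GrassmannLinear.
Variables (K : comNzRingType) (d : nat).
Notation G := (grass K d).

Definition glin (u : 'I_d -> K) : G := \sum_i u i *: gtheta K i.

Lemma glin_homog u : glin u \in homog true.
Proof. by rewrite rpred_sum // => i _; rewrite rpredZ // gtheta_homog. Qed.

Lemma sum_ffun_lift k (h : 'I_k.+1) (E : nmodType) (F : {ffun 'I_k.+1 -> 'I_d} -> E) :
  \sum_f F f = \sum_i \sum_(g : {ffun 'I_k -> 'I_d})
    F [ffun j => if unlift h j is Some j' then g j' else i].
Proof.
pose join (p : 'I_d * {ffun 'I_k -> 'I_d}) : {ffun 'I_k.+1 -> 'I_d} :=
  [ffun j => if unlift h j is Some j' then p.2 j' else p.1].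
rewrite pair_bigA (reindex join) //.
exists (fun f : {ffun 'I_k.+1 -> 'I_d} => (f h, [ffun i => f (lift h i)])) => [[i g]|f] _.
  congr pair; rewrite ?ffunE ?unlift_none //.
  by apply/ffunP => j; rewrite !ffunE liftK.
apply/ffunP => j; rewrite ffunE; case: unliftP => [j' ->|-> //].
by rewrite ffunE.
Qed.

Lemma sign_mulr_scale j (x : G) : (-1) ^+ j * x = (-1) ^+ j *: x.
Proof. by rewrite -signr_odd mulr_sign -[in RHS]signr_odd scaler_sign. Qed.

(** The sign comes from moving the generator of slot [h] to the front; it will cancel the
    alternating sign of [dOmega] up to a global minus. *)
Lemma gext_front k (h : 'I_k.+1) (u : 'I_d -> K) (F : {ffun 'I_k -> 'I_d} -> K) :
  gext (fun f : {ffun 'I_k.+1 -> 'I_d} => u (f h) * F [ffun i => f (lift h i)]) =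
  (-1) ^+ h *: (glin u * gext F).
Proof.
rewrite /gext (sum_ffun_lift h) /glin big_distrlr scaler_sumr; apply: eq_bigr => i _ /=.
rewrite scaler_sumr; apply: eq_bigr => g _.
pose f : {ffun 'I_k.+1 -> 'I_d} := [ffun j => if unlift h j is Some j' then g j' else i].
rewrite -/f; have fh : f h = i by rewrite ffunE unlift_none.
have fl j : f (lift h j) = g j by rewrite ffunE liftK.
have -> : [ffun j => f (lift h j)] = g by apply/ffunP => j; rewrite ffunE fl.
have := prod_anticomm_front h (fun i' j' => gthetaC K (f i') (f j')).
rewrite fh (eq_bigr (fun j => gtheta K (g j))) => [e|j _]; last by rewrite fl.
rewrite -scalerAl -scalerAr e sign_mulr_scale !scalerA; congr (_ *: _).
by rewrite [RHS]mulrC !mulrA -expr2 sqrr_sign mul1r.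
Qed.

Lemma gext_back k (h : 'I_k.+1) (u : 'I_d -> K) (F : {ffun 'I_k -> 'I_d} -> K) :
  gext (fun f : {ffun 'I_k.+1 -> 'I_d} => F [ffun i => f (lift h i)] * u (f h)) =
  (-1) ^+ (k + h) *: (gext F * glin u).
Proof.
rewrite /gext (sum_ffun_lift h) exchange_big /glin big_distrlr scaler_sumr.
apply: eq_bigr => g _ /=; rewrite scaler_sumr; apply: eq_bigr => i _.
pose f : {ffun 'I_k.+1 -> 'I_d} := [ffun j => if unlift h j is Some j' then g j' else i].
rewrite -/f; have fh : f h = i by rewrite ffunE unlift_none.
have fl j : f (lift h j) = g j by rewrite ffunE liftK.
have -> : [ffun j => f (lift h j)] = g by apply/ffunP => j; rewrite ffunE fl.
have := prod_anticomm_back h (fun i' j' => gthetaC K (f i') (f j')).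
rewrite fh (eq_bigr (fun j => gtheta K (g j))) => [e|j _]; last by rewrite fl.
rewrite -scalerAl -scalerAr e sign_mulr_scale !scalerA; congr (_ *: _).
by rewrite [RHS]mulrC !mulrA -expr2 sqrr_sign mul1r.
Qed.

Lemma gextD k (F H : {ffun 'I_k -> 'I_d} -> K) :
  gext (fun f => F f + H f) = gext F + gext H.
Proof.
by rewrite /gext -big_split; apply: eq_bigr => f _; rewrite scalerDl.
Qed.

Lemma gext_gt k (F : {ffun 'I_k -> 'I_d} -> K) : (d < k)%N -> gext F = 0.
Proof.
move=> dk; apply: big1 => f _; rewrite prod_gtheta_noninj ?scaler0 //.
by apply/negP => /injectiveP /leq_card; rewrite !card_ord leqNgt dk.
Qed.

End GrassmannLinear.

(** * Powers of the generic matrix and their traces *)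

Section GrassmannMatrices.
Variables (K : comNzRingType) (d m : nat).
Notation G := (grass K d).
Implicit Type v : 'I_d -> 'M[K]_m.

Definition gmx k (F : {ffun 'I_k -> 'I_d} -> 'M[K]_m) : 'M[G]_m :=
  \matrix_(a, b) gext (fun f => F f a b).

Definition gincl v : 'M[G]_m := \matrix_(a, b) glin (fun i => v i a b).

Lemma gincl_pow v k :
  gincl v ^+ k = gmx (fun f : {ffun 'I_k -> 'I_d} => \prod_i v (f i)).
Proof.
elim: k => [|k IH].
  have f0 : {ffun 'I_0 -> 'I_d} := ffun0 (card_ord 0).
  apply/matrixP => a b; rewrite expr0 !mxE /gext (big_pred1 f0); last first.
    by move=> f; rewrite /=; apply/esym/eqP/ffunP => -[].
  by rewrite !big_ord0 mxE; case: (a == b); rewrite ?scale1r ?scale0r.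
apply/matrixP => a b; rewrite exprS IH !mxE.
transitivity (gext (fun f : {ffun 'I_k.+1 -> 'I_d} => \sum_c v (f ord0) a c *
    (fun g : {ffun 'I_k -> 'I_d} => (\prod_i v (g i)) c b) [ffun i => f (lift ord0 i)])).
  rewrite gext_sum; apply: eq_bigr => c _.
  by rewrite (gext_front ord0 (fun i => v i a c)
    (fun g : {ffun 'I_k -> 'I_d} => (\prod_i v (g i)) c b))
    scale1r !mxE.
apply: eq_gext => f; rewrite big_ord_recl mxE; apply: eq_bigr => c _.
by congr (_ * (_ : 'M_m) c b); apply: eq_bigr => i _; rewrite ffunE.
Qed.

Lemma gtop_gincl_pow v :
  map_mx (@gtop K d) (gincl v ^+ d) =
  \sum_(s : 'S_d) (-1) ^+ s *: \prod_i v (s i).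
Proof.
apply/matrixP => a b; rewrite gincl_pow !mxE gtop_gext summxE.
apply: eq_bigr => s _; rewrite [RHS]mxE; congr (_ * (_ : 'M_m) a b).
by apply: eq_bigr => i _; rewrite ffunE.
Qed.

Lemma gincl_nilp v k : (d < k)%N -> gincl v ^+ k = 0.
Proof.
by move=> dk; rewrite gincl_pow; apply/matrixP => a b; rewrite !mxE gext_gt.
Qed.

Lemma gincl_pow_homog v k a b : (gincl v ^+ k) a b \in homog (odd k).
Proof.
elim: k a b => [|k IH] a b.
  by rewrite expr0 mxE; case: (a == b); rewrite ?mulr1n ?mulr0n ?homog1 ?rpred0.
rewrite exprS mxE rpred_sum // => c _; rewrite -[odd _]/(true (+) odd k).
by apply: homogM; rewrite ?mxE ?glin_homog.
Qed.

Lemma mxtrace_odd_mulC (A B : 'M[G]_m) :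
  (forall a b, A a b \in homog true) -> (forall a b, B a b \in homog true) ->
  \tr (A *m B) = - \tr (B *m A).
Proof.
move=> hA hB; rewrite /mxtrace -sumrN.
under eq_bigr do rewrite mxE.
rewrite exchange_big; apply: eq_bigr => b _ /=; rewrite mxE -sumrN.
by apply: eq_bigr => a _; rewrite (homog_comm (hA _ _) (hB _ _)) mulN1r.
Qed.

(** Split off one factor: both parts have odd entries, so the trace is its own opposite. The factor
    2 stays because [K] may have 2-torsion here. *)
Lemma trace_gincl_pow v j : \tr (gincl v ^+ j.+1.*2) *+ 2 = 0.
Proof.
have e : \tr (gincl v ^+ j.+1.*2) = - \tr (gincl v ^+ j.+1.*2).
  have -> : j.+1.*2 = j.*2.+2 by [].
  rewrite [in LHS]exprS [in RHS]exprSr; apply: mxtrace_odd_mulC => a b.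
    by rewrite -[gincl v]expr1 gincl_pow_homog.
  by have := gincl_pow_homog v j.*2.+1 a b; rewrite /= odd_double.
by rewrite mulr2n {2}e subrr.
Qed.

End GrassmannMatrices.

(** * The square of the generic matrix over the even part *)

Section Curvature.
Variables (K : numFieldType) (d n : nat).
Notation m := n.+1.*2.
Notation G := (grass K d).
Notation E := (geven K d).
Variable v : 'I_d -> symM K m.
Let X : 'M[G]_m := gincl (fun i => v i : 'M[K]_m).

Lemma grass_torsionfree k (x : G) : x *+ k.+1 = 0 -> x = 0.
Proof.
rewrite -scaler_nat => /(congr1 (GRing.scale (k.+1%:R^-1 : K))).
by rewrite scaler0 scalerA mulVf ?pnatr_eq0 // scale1r.
Qed.

Lemma geven_torsionfree k (x : E) : x *+ k.+1 = 0 -> x = 0.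
Proof.
move=> /(congr1 val); rewrite rmorphMn => /grass_torsionfree e.
by apply: val_inj.
Qed.

Definition gincl2 : 'M[E]_m :=
  \matrix_(a, b) \sum_i \sum_j (v i *m v j) a b *: gtt K i j.

Lemma val_gincl2 : map_mx val gincl2 = X ^+ 2.
Proof.
apply/matrixP => a b; rewrite expr2 !mxE raddf_sum.
under eq_bigr do rewrite raddf_sum.
transitivity (\sum_i \sum_j \sum_c (v i a c * v j c b) *: (gtheta K i * gtheta K j)).
  apply: eq_bigr => i _; apply: eq_bigr => j _.
  by rewrite [LHS]linearZ /= mxE scaler_suml.
rewrite pair_bigA exchange_big /=; apply: eq_bigr => c _.
rewrite !mxE /glin big_distrlr pair_bigA; apply: eq_bigr => -[i j] _ /=.
by rewrite -scalerAl -scalerAr scalerA.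
Qed.

Lemma gincl2_skew : gincl2^T = - gincl2.
Proof.
apply/matrixP => a b; rewrite !mxE exchange_big -sumrN; apply: eq_bigr => i _ /=.
rewrite -sumrN; apply: eq_bigr => j _; rewrite gttC scalerN; congr (- (_ *: _)).
have <- : (v j *m v i)^T = v i *m v j.
  by rewrite trmx_mul (eqP (symvalP (v i))) (eqP (symvalP (v j))).
by rewrite [RHS]mxE.
Qed.

(** Source of the powers of 2: both terms of the bracket contribute the same amount, since [gtt] is
    antisymmetric. *)
Lemma sum_lie a b :
  \sum_i \sum_j lie (v i) (v j) a b *: gtt K i j = gincl2 a b *+ 2.
Proof.
rewrite mulr2n [X in _ + X]mxE [in X in _ + X]exchange_big mxE -big_split.
apply: eq_bigr => i _; rewrite -big_split; apply: eq_bigr => j _ /=.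
by rewrite (gttC _ j i) scalerN -scalerBl /lie !mxE.
Qed.

Lemma gincl2_pow k : map_mx val (gincl2 ^+ k) = X ^+ k.*2.
Proof.
elim: k => [|k IH]; first by rewrite !expr0 (map_mx1 (val : E -> G)).
by rewrite exprS (map_mxM (val : E -> G)) IH val_gincl2 mulmxE -exprD.
Qed.

Lemma gincl2_adj : \adj gincl2 = - gincl2 ^+ n.*2.+1.
Proof.
(* The power [d.+1] has degree [2 * d.+1] in only [d] generators. *)
rewrite (@adj_nilp _ _ _ d.+1) //.
- by rewrite -signr_odd /= odd_double expr1 scaleN1r.
- exact: geven_torsionfree.
- have := gincl2_pow d.+1; rewrite [in RHS]/X gincl_nilp; last by lia.
  move=> e; apply/matrixP => a b; apply: val_inj.
  by have /matrixP/(_ a b) := e; rewrite [LHS]mxE !mxE rmorph0.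
- move=> j; apply: (geven_torsionfree (k := 1)); apply: val_inj.
  rewrite rmorphMn rmorph0 -(trace_map_mx (val : E -> G)) gincl2_pow.
  exact: trace_gincl_pow.
Qed.

(** The constant of [pfadj_adj] at [stdJ], divided by the squared Pfaffian of [stdJ]; its minus sign
    cancels that of [gincl2_adj]. *)
Definition kappa : K :=
  \det (stdJ n K) * m%:R / (2 ^ n.+1 * n.+1`!)%:R ^+ 2.

Lemma kappa_neq0 : kappa != 0.
Proof.
have c0 : (2 ^ n.+1 * n.+1`!)%:R != 0 :> K.
  by rewrite pnatr_eq0 muln_eq0 expn_eq0 /= -lt0n fact_gt0.
apply: mulf_neq0; last by rewrite invr_neq0 // expf_neq0.
apply: mulf_neq0; last by rewrite pnatr_eq0.
(* [stdJ] has an inverse up to a nonzero scalar, so its determinant is nonzero. *)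
have := mul_pfadj (stdJ_skew n K); rewrite pf_stdJ => /(congr1 (@determinant _ _)).
rewrite -scaler_nat scalemxAr det_mulmx det_scalar => e.
have : \det (stdJ n K) * \det (m%:R *: (pfadj (stdJ n K))^T) != 0 by rewrite e expf_neq0.
by rewrite mulf_eq0 negb_or => /andP[].
Qed.

Lemma gincl2_pow_top a b :
  (gincl2 ^+ n.*2.+1) a b = kappa *: (pf (fun=> gincl2) * pfadj gincl2 a b).
Proof.
have c0 : (2 ^ n.+1 * n.+1`!)%:R != 0 :> K.
  by rewrite pnatr_eq0 muln_eq0 expn_eq0 /= -lt0n fact_gt0.
have rJ : regular (pf (fun=> stdJ n E)).
  move=> x; rewrite pf_stdJ mulr_natl.
  have : (0 < 2 ^ n.+1 * n.+1`!)%N by rewrite muln_gt0 expn_gt0 fact_gt0.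
  by move/prednK <- => /geven_torsionfree.
have := pfadj_adj geven_torsionfree gincl2_skew (stdJ_skew n E) rJ.
rewrite gincl2_adj pf_stdJ -(rmorph_stdJ n (in_alg E)) det_map_mx /=.
have -> : pfadj gincl2 a b = pfder gincl2 (delta_mx a b) by rewrite mxE.
move=> /matrixP/(_ a b); rewrite mulmxnE 4!mxE [in RHS]mxE.
set x := (gincl2 ^+ _) a b; set y := pfder _ _; set c := (_ * _)%N in c0 *.
rewrite mulrN mulNrn => /oppr_inj e.
have : (c%:R ^+ 2 : K) *: x = (\det (stdJ n K) * m%:R) *: (pf (fun=> gincl2) * y).
  rewrite -[LHS]mulr_algl -[_%:A]/(in_alg E _) rmorphXn rmorph_nat e.
  by rewrite -mulrA mulr_algl mulr_natr scalerMnl.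
move/(congr1 (GRing.scale ((c%:R ^+ 2)^-1 : K))).
rewrite !scalerA mulVf ?expf_neq0 // scale1r => ->.
by rewrite [kappa]mulrC.
Qed.

Definition Pv : G := val (pf (fun=> gincl2)).
Definition Dv : 'M[G]_m := map_mx val (pfadj gincl2).

Lemma gincl_pow_top a b : (X ^+ n.*2.+1.*2) a b = kappa *: (Pv * Dv a b).
Proof.
by rewrite -gincl2_pow mxE gincl2_pow_top [LHS]linearZ [Dv a b]mxE -rmorphM.
Qed.

Lemma Pv_comm (x : G) : Pv * x = x * Pv.
Proof.
pose part b : G := [ffun S : {set 'I_d} => if odd #|S| == b then x S else 0].
have hp b : part b \in homog b.
  by apply/homogP => S /negbTE nS; rewrite ffunE nS.
have -> : x = part false + part true.
  by apply/ffunP => S; rewrite !ffunE; case: odd; rewrite ?addr0 ?add0r.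
have comm b : Pv * part b = part b * Pv.
  by rewrite (homog_comm (geven_valP _) (hp b)) mul1r.
by rewrite mulrDl mulrDr !comm.
Qed.

End Curvature.

(** * The forms Q, Omega and dOmega *)

(** With as many generators as arguments, a wedge is a top coefficient; for alternating forms the
    prefactor undoes the factorials by which [gext] overcounts. *)
Lemma wedge_gext (K : numFieldType) (U : lmodType K) p h k
    (F : {ffun 'I_h -> U} -> K) (H : {ffun 'I_k -> U} -> 'M[K]_p)
    (v : {ffun 'I_(h + k) -> U}) a b :
  wedge F H v a b = (h`! * k`!)%:R^-1 *
    gtop (gext (fun f : {ffun 'I_h -> 'I_(h + k)} => F [ffun i => v (f i)]) *
          gext (fun f : {ffun 'I_k -> 'I_(h + k)} => H [ffun i => v (f i)] a b)).
Proof.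
rewrite /wedge mxE summxE gext_mul gtop_gext; congr (_ * _).
apply: eq_bigr => s _; rewrite !mxE; congr (_ * (F _ * H _ a b)).
  by apply/ffunP => i; rewrite !ffunE.
by apply/ffunP => i; rewrite !ffunE.
Qed.

Section Covariants.
Variables (K : numFieldType) (d n : nat).
Notation m := n.+1.*2.
Notation G := (grass K d).
Variable v : 'I_d -> symM K m.

Lemma gext_prod_lie N (a b : 'I_N -> 'I_m) :
  gext (fun f : {ffun 'I_N.*2 -> 'I_d} =>
    \prod_(k < N) lie (v (f (ord_ev k))) (v (f (ord_od k))) (a k) (b k)) =
  2 ^+ N *: val (\prod_(k < N) gincl2 v (a k) (b k)) :> G.
Proof.
rewrite /gext -(prod_ord_pairs (@gtheta K d) (fun k i j => lie (v i) (v j) (a k) (b k))).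
have -> : 2 ^+ N = \prod_(k < N) (2 : K) by rewrite prodr_const card_ord.
rewrite rmorph_prod -scaler_prod.
apply: eq_bigr => k _.
have -> : 2 *: val (gincl2 v (a k) (b k)) = val (gincl2 v (a k) (b k) *+ 2) :> G.
  by rewrite raddfMn scaler_nat.
rewrite -sum_lie raddf_sum.
apply: eq_bigr => i _; rewrite raddf_sum; apply: eq_bigr => j _.
by rewrite [RHS]linearZ.
Qed.

Lemma val_signM j (x : geven K d) : val ((-1) ^+ j * x) = (-1) ^+ j *: val x :> G.
Proof. by rewrite rmorphM rmorph_sign sign_mulr_scale. Qed.

Lemma val_signM_alg j (x : geven K d) z :
  val ((-1) ^+ j * (x * in_alg (geven K d) z)) = ((-1) ^+ j * z) *: val x :> G.
Proof. by rewrite val_signM mulr_algr -scalerA; congr (_ *: _); rewrite [LHS]linearZ. Qed.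

(** The factorial comes from the antisymmetrization in [Qform], the power of 2 from its brackets. *)
Lemma gext_Qform :
  gext (fun f : {ffun 'I_m -> 'I_d} => Qform K n.+1 [ffun i => v (f i)]) =
  m`!%:R *: (2 ^+ n.+1 *: Pv v).
Proof.
have e : gext (fun f : {ffun 'I_m -> 'I_d} =>
    pf (fun k => lie (v (f (ord_ev k))) (v (f (ord_od k))))) = 2 ^+ n.+1 *: Pv v.
  rewrite /pf gext_sum /Pv /pf raddf_sum scaler_sumr; apply: eq_bigr => s _.
  by rewrite gextZ gext_prod_lie [X in _ = _ *: X]val_signM !scalerA mulrC.
rewrite -e -gext_alt; apply: eq_gext => f; apply: eq_bigr => s _; congr (_ * _).
rewrite polpfE; apply: eq_bigr => t _; congr (_ * _); apply: eq_bigr => k _.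
by rewrite !ffunE.
Qed.

Lemma prod_Omega_args (w : {ffun 'I_n.*2 -> symM K m}) (Z : 'M[K]_m) (s : 'S_m) :
  \prod_k (@Omega_args K n.+1 w Z) k (s (ord_ev k)) (s (ord_od k)) =
  (\prod_(k < n) lie (w (ord_ev k)) (w (ord_od k))
     (s (ord_ev (widen_ord (leqnSn n) k))) (s (ord_od (widen_ord (leqnSn n) k)))) *
  Z (s (ord_ev ord_max)) (s (ord_od ord_max)).
Proof.
rewrite big_ord_recr /=; congr (_ * _).
  by apply: eq_bigr => k _; rewrite ffunE /= (valK k).
by rewrite ffunE insubF //= ltnn.
Qed.

(** [Z] sits in the last slot, so [pf_pfder] is used at [ord_max] and only [n] brackets bring a
    factor 2. *)
Lemma gext_polpf_Omega (Z : 'M[K]_m) :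
  gext (fun f : {ffun 'I_n.*2 -> 'I_d} => polpf (@Omega_args K n.+1 [ffun i => v (f i)] Z)) =
  2 ^+ n *: val (pfder (gincl2 v) (map_mx (in_alg (geven K d)) Z)).
Proof.
rewrite -(pf_pfder _ _ ord_max) /pf raddf_sum scaler_sumr.
transitivity (gext (fun f : {ffun 'I_n.*2 -> 'I_d} => \sum_(s : 'S_m)
  ((-1) ^+ s * Z (s (ord_ev ord_max)) (s (ord_od ord_max))) *
  (\prod_(k < n) lie (v (f (ord_ev k))) (v (f (ord_od k)))
     (s (ord_ev (widen_ord (leqnSn n) k))) (s (ord_od (widen_ord (leqnSn n) k)))))).
  apply: eq_gext => f; rewrite polpfE; apply: eq_bigr => s _.
  rewrite prod_Omega_args [RHS]mulrAC mulrA; congr (_ * _ * _).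
  by apply: eq_bigr => k _; rewrite !ffunE.
rewrite gext_sum; apply: eq_bigr => s _; rewrite gextZ gext_prod_lie.
rewrite big_ord_recr /= eqxx mxE.
have -> : \prod_(i < n) (if widen_ord (leqnSn n) i == ord_max
      then map_mx (in_alg (geven K d)) Z else gincl2 v)
      (s (ord_ev (widen_ord (leqnSn n) i))) (s (ord_od (widen_ord (leqnSn n) i))) =
    \prod_(i < n) gincl2 v (s (ord_ev (widen_ord (leqnSn n) i)))
      (s (ord_od (widen_ord (leqnSn n) i))).
  apply: eq_bigr => k _; case: ifP => // /eqP /(congr1 val) /= ek.
  by have := ltn_ord k; rewrite ek ltnn.
by rewrite [X in _ = _ *: X]val_signM_alg !scalerA mulrC.
Qed.

Lemma ewedgeE i j a b :
  ewedge K m i j a b = ((a == i) && (b == j))%:R - ((a == j) && (b == i))%:R.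
Proof.
by rewrite /ewedge /tens !mxE !big_ord1 !mxE !andbT -!natrM !mulnb.
Qed.

Lemma sum_ewedge (E : lmodType K) (x : 'I_m -> 'I_m -> E) a b :
  (forall i j, x j i = - x i j) ->
  \sum_(i < m) \sum_(j < m | (i < j)%N) ewedge K m i j a b *: x i j = x a b.
Proof.
move=> xN.
have S a' b' : \sum_(i < m) \sum_(j < m | (i < j)%N) ((a' == i) && (b' == j))%:R *: x i j =
    if (a' < b')%N then x a' b' else 0 :> E.
  rewrite (bigD1 a') //= [X in _ + X]big1 ?addr0 => [|i ni]; last first.
    by apply: big1 => j _; rewrite eq_sym (negbTE ni) scale0r.
  case: ifP => ab; last first.
    apply: big1 => j aj; case: (eqVneq b' j) aj => [<-|_ _]; first by rewrite ab.
    by rewrite andbF scale0r.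
  rewrite (bigD1 b') //= !eqxx scale1r big1 ?addr0 // => j /andP[_ nj].
  by rewrite [b' == j]eq_sym (negbTE nj) andbF scale0r.
transitivity ((if (a < b)%N then x a b else 0) - (if (b < a)%N then x b a else 0)).
  rewrite -!S -sumrB; apply: eq_bigr => i _; rewrite -sumrB; apply: eq_bigr => j _.
  by rewrite ewedgeE scalerBl [(b == i) && _]andbC.
case: ltngtP => [||/val_inj ->]; rewrite ?subr0 ?sub0r // -?xN //.
(* On the diagonal [x b b] is its own opposite, hence zero. *)
have /eqP := xN b b; rewrite -addr_eq0 -mulr2n -scaler_nat scaler_eq0 pnatr_eq0 /=.
by move/eqP->.
Qed.

Lemma pfder_ewedge i j :
  val (pfder (gincl2 v) (map_mx (in_alg (geven K d)) (ewedge K m i j))) = 2 *: Dv v i j :> G.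
Proof.
have -> : map_mx (in_alg (geven K d)) (ewedge K m i j) = delta_mx i j - delta_mx j i.
  by apply/matrixP => a b; rewrite mxE ewedgeE !mxE rmorphB !rmorph_nat.
have -> : Dv v i j = val (pfder (gincl2 v) (delta_mx i j)) by rewrite !mxE.
rewrite scaler_nat -raddfMn; congr val.
by rewrite linearB /= -[delta_mx j i]trmx_delta pfder_tr opprK mulr2n.
Qed.

(** The last factor 2 comes from [ewedge], whose two terms contribute equally to [pfder]. *)
Lemma gext_Omega a b :
  gext (fun f : {ffun 'I_n.*2 -> 'I_d} => Omega K n.+1 [ffun i => v (f i)] a b) =
  n.*2`!%:R *: (2 ^+ n.+1 *: Dv v a b).
Proof.
have DN i j : Dv v j i = - Dv v i j.
  rewrite /Dv !mxE -rmorphN; congr val.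
  by have /matrixP/(_ i j) := pfadj_skew (gincl2 v); rewrite !mxE.
rewrite -(sum_ewedge a b DN).
pose F i j (f : {ffun 'I_n.*2 -> 'I_d}) :=
  polpf (@Omega_args K n.+1 [ffun l => v (f l)] (ewedge K m i j)).
transitivity (\sum_(i < m) \sum_(j < m | (i < j)%N) ewedge K m i j a b *:
  gext (fun f => \sum_(s : 'S_n.*2) (-1) ^+ s * F i j [ffun l => f (s l)])).
  under [RHS]eq_bigr do under eq_bigr do rewrite -gextZ.
  under [RHS]eq_bigr do rewrite -gext_sum.
  rewrite -gext_sum; apply: eq_gext => f; rewrite /Omega summxE.
  apply: eq_bigr => i _; rewrite summxE; apply: eq_bigr => j _.
  rewrite summxE mulr_sumr; apply: eq_bigr => s _.
  have -> : vperm [ffun l => v (f l)] s = [ffun l => v ([ffun l' => f (s l')] l)].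
    by apply/ffunP => l; rewrite !ffunE.
  by rewrite [LHS]mxE mulrC.
rewrite !scaler_sumr; apply: eq_bigr => i _; rewrite !scaler_sumr; apply: eq_bigr => j _.
rewrite gext_alt /F gext_polpf_Omega pfder_ewedge !scalerA; congr (_ *: _).
by rewrite exprS; ring.
Qed.

Lemma gext_dOmega a b :
  gext (fun f : {ffun 'I_n.*2.+1 -> 'I_d} => dOmega K n.+1 [ffun i => v (f i)] a b) =
  - (n.*2.+1)`!%:R *: (2 ^+ n.+1 *:
    (gincl (fun i => v i : 'M[K]_m) *m Dv v + Dv v *m gincl (fun i => v i : 'M[K]_m)) a b).
Proof.
pose O i j (g : {ffun 'I_n.*2 -> 'I_d}) := Omega K n.+1 [ffun l => v (g l)] i j.
transitivity (\sum_(h < n.*2.+1) (-1) ^+ h.+1 *: \sum_c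
  (gext (fun f => v (f h) a c * O c b [ffun l => f (lift h l)]) +
   gext (fun f => O a c [ffun l => f (lift h l)] * v (f h) c b))).
  under [RHS]eq_bigr do under eq_bigr do rewrite -gextD.
  under [RHS]eq_bigr do rewrite -gext_sum -gextZ.
  rewrite -gext_sum; apply: eq_gext => f; rewrite /dOmega summxE.
  apply: eq_bigr => h _; rewrite mxE; congr (_ * _).
  rewrite /skew_act (eqP (symvalP _)) mxE !mxE -big_split; apply: eq_bigr => c _ /=.
  have -> : [ffun i => [ffun l => v (f l)] (lift h i)] =
      [ffun l => v ([ffun l' => f (lift h l')] l)].
    by apply/ffunP => l; rewrite !ffunE.
  by rewrite ffunE.
(* Every [h] contributes the same: [(-1) ^+ h.+1] meets the sign [(-1) ^+ h] of either placement, as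
   [n.*2] is even. The [n.*2.+1] values of [h] complete the factorial. *)
pose c0 : K := - (n.*2`!%:R * 2 ^+ n.+1).
transitivity (\sum_(h < n.*2.+1) c0 *: 
    (gincl (fun i => v i : 'M[K]_m) *m Dv v + Dv v *m gincl (fun i => v i : 'M[K]_m)) a b).
  apply: eq_bigr => h _; rewrite !mxE -big_split !scaler_sumr; apply: eq_bigr => c _ /=.
  rewrite (gext_front h (fun i => v i a c) (O c b)) (gext_back h (fun i => v i c b) (O a c)).
  rewrite !gext_Omega exprD -(signr_odd _ n.*2) odd_double mul1r -scalerDr [LHS]scalerA.
  rewrite exprS mulN1r mulNr -expr2 sqrr_sign scaleN1r /c0 scaleNr; congr (- _).
  rewrite !scalerA -scalerAl -scalerAr -scalerDr.
  by rewrite [gincl _ a c]mxE [gincl _ c b]mxE.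
rewrite sumr_const card_ord -scaler_nat !scalerA /c0 factS natrM; congr (_ *: _); ring.
Qed.

End Covariants.

(** * Comparison of top coefficients *)

Section Identities.
Variables (K : numFieldType) (n : nat).
Notation m := n.+1.*2.

Lemma Xpow_gtop d (v : {ffun 'I_d -> symM K m}) :
  Xpow K m d v = map_mx (@gtop K d) (gincl (fun i => v i : 'M[K]_m) ^+ d).
Proof. by rewrite gtop_gincl_pow. Qed.

Lemma fact_neq0 k : k`!%:R != 0 :> K.
Proof. by rewrite pnatr_eq0 -lt0n fact_gt0. Qed.

Lemma expr4E k : 4 ^+ k = 2 ^+ k * 2 ^+ k :> K.
Proof. by rewrite -exprMn -natrM. Qed.

Lemma Xpow_wedge_Omega (v : {ffun 'I_(m + n.*2) -> symM K m}) :
  Xpow K m (m + n.*2) v =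
  (kappa K n / 4 ^+ n.+1) *: wedge (Qform K n.+1) (Omega K n.+1) v.
Proof.
apply/matrixP => a b; rewrite [RHS]mxE wedge_gext gext_Qform gext_Omega.
rewrite Xpow_gtop mxE.
have eX (Y : 'M[grass K (m + n.*2)]_m) : Y ^+ (m + n.*2) = Y ^+ n.*2.+1.*2.
  by congr (_ ^+ _); lia.
rewrite eX gincl_pow_top -!(scalerAl, scalerAr) !linearZ /= expr4E natrM.
set t := gtop _; set c := 2 ^+ n.+1; have c0 : c != 0 by rewrite expf_neq0 // pnatr_eq0.
have := fact_neq0 m; have := fact_neq0 n.*2.
set f := m`!%:R; set g := n.*2`!%:R => g0 f0.
by field; rewrite c0 f0 g0.
Qed.

Lemma Xpow_wedge_dOmega (v : {ffun 'I_(m + n.*2.+1) -> symM K m}) :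
  Xpow K m (m + n.*2.+1) v =
  - (kappa K n / 4 ^+ n.+1 / 2) *: wedge (Qform K n.+1) (dOmega K n.+1) v.
Proof.
apply/matrixP => a b; rewrite [RHS]mxE wedge_gext gext_Qform gext_dOmega.
rewrite Xpow_gtop mxE; set X := gincl _.
have eX : X ^+ (m + n.*2.+1) = X ^+ n.*2.+1.*2.+1 by congr (_ ^+ _); lia.
pose P := Pv v; pose D := Dv v.
have eXD : (X ^+ n.*2.+1.*2.+1) a b = kappa K n *: (P * (X *m D) a b).
  rewrite exprS !mxE mulr_sumr scaler_sumr; apply: eq_bigr => c _.
  by rewrite gincl_pow_top -scalerAr [in LHS]mulrA -(Pv_comm v) -mulrA.
have eDX : (X ^+ n.*2.+1.*2.+1) a b = kappa K n *: (P * (D *m X) a b).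
  rewrite exprSr !mxE mulr_sumr scaler_sumr; apply: eq_bigr => c _.
  by rewrite gincl_pow_top -scalerAl mulrA.
(* Left and right multiplication by [X] give the same power, so the sum counts it twice; this is the
   extra [1/2] in the constant. *)
have e2 : gtop ((X ^+ n.*2.+1.*2.+1) a b) =
    kappa K n / 2 * gtop (P * (X *m D + D *m X) a b).
  have -> : (X *m D + D *m X) a b = (X *m D) a b + (D *m X) a b by rewrite mxE.
  rewrite mulrDr linearD /= mulrDr.
  have x1 : gtop (P * (X *m D) a b) = gtop ((X ^+ n.*2.+1.*2.+1) a b) / kappa K n.
    by rewrite eXD [gtop (_ *: _)]linearZ mulrC mulKf ?kappa_neq0.
  have x2 : gtop (P * (D *m X) a b) = gtop ((X ^+ n.*2.+1.*2.+1) a b) / kappa K n.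
    by rewrite eDX [gtop (_ *: _)]linearZ mulrC mulKf ?kappa_neq0.
  rewrite x1 x2; move: (gtop _) => t.
  by field; rewrite kappa_neq0.
rewrite eX e2 -/P -/D -!(scalerAl, scalerAr) !linearZ /= expr4E natrM.
set t := gtop _; set c := 2 ^+ n.+1; have c0 : c != 0 by rewrite expf_neq0 // pnatr_eq0.
have := fact_neq0 m; have := fact_neq0 n.*2.+1.
set f := m`!%:R; set g := n.*2.+1`!%:R => g0 f0.
by field; rewrite c0 f0 g0.
Qed.

End Identities.

(** * Covariance of the standard polynomial *)

Section XpowCovariant.
Variables (K : numFieldType) (m a : nat).
Notation MS := (symM K m).

Lemma prod_linear_slot k (j : 'I_k) (w : 'I_k -> 'M[K]_m) (c : K) (x y : 'M[K]_m) :
  \prod_(i < k) (if i == j then c *: x + y else w i) =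
  c *: \prod_(i < k) (if i == j then x else w i) + \prod_(i < k) (if i == j then y else w i).
Proof.
elim: k j w => [|k IH] j w; first by case: j.
rewrite !big_ord_recl; case: (unliftP ord0 j) => [j' ->|->] /=.
  have e z : \prod_(i < k) (if lift ord0 i == lift ord0 j' then z else w (lift ord0 i)) =
    \prod_(i < k) (if i == j' then z else w (lift ord0 i)).
    by apply: eq_bigr => i _; rewrite (inj_eq (@lift_inj _ ord0)).
  by rewrite !e IH -mulmxE mulmxDr scalemxAr.
by rewrite -mulmxE mulmxDl scalemxAl.
Qed.

Lemma Xpow_multilinear : multilinear (@Xpow K m a).
Proof.
move=> v i c x y; rewrite /Xpow scaler_sumr -big_split; apply: eq_bigr => s _ /=.
have e z : \prod_(j < a) (vset v i z (s j) : 'M[K]_m) =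
    \prod_(j < a) (if j == (s^-1)%g i then (z : 'M[K]_m) else v (s j)).
  apply: eq_bigr => j _; rewrite ffunE -[in LHS](permKV s i) (inj_eq perm_inj).
  by case: eqP.
rewrite !e (_ : symval (c *: x + y) = c *: (x : 'M[K]_m) + y); last by [].
by rewrite prod_linear_slot scalerDr !scalerA mulrC.
Qed.

Lemma Xpow_alternating : alternating (@Xpow K m a).
Proof.
move=> v i j nij vij; pose t := tperm i j.
have vt k : v (t k) = v k by rewrite /t; case: tpermP => [->|->|].
have e : Xpow K m a v = - Xpow K m a v.
  rewrite [LHS](reindex_inj (mulIg t)) /= -sumrN; apply: eq_bigr => s _.
  rewrite odd_permM odd_tperm nij addbT -scaleNr; congr (_ *: _).
    by case: odd_perm; rewrite ?opprK.
  by apply: eq_bigr => k _; rewrite permM vt.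
have /eqP := e; rewrite -addr_eq0 -mulr2n -scaler_nat scaler_eq0 pnatr_eq0 /=.
by move/eqP.
Qed.

Lemma Xpow_equivariant g (v : {ffun 'I_a -> MS}) : g \in SO K m ->
  Xpow K m a [ffun i => symM_conj g (v i)] = g *m Xpow K m a v *m invmx g.
Proof.
move=> /andP[/eqP gg /eqP dg].
have ug : g \in unitmx by rewrite unitmxE dg unitr1.
have -> : invmx g = g^T by rewrite -[RHS]mul1mx -(mulVmx ug) -mulmxA gg mulmx1.
have gg' : g^T *m g = 1%:M by apply: mulmx1C.
rewrite /Xpow mulmx_sumr mulmx_suml; apply: eq_bigr => s _.
rewrite -scalemxAr -scalemxAl; congr (_ *: _).
elim: (index_enum _) => [|i r IH]; first by rewrite !big_nil mulmx1 gg.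
rewrite !big_cons IH ffunE /= -!mulmxE !mulmxA; congr (_ *m _).
by rewrite -(mulmxA _ g^T g) gg' mulmx1 .
Qed.

Lemma Xpow_covariant : covariant (@Xpow K m a).
Proof.
split; [exact: Xpow_multilinear | exact: Xpow_alternating | exact: Xpow_equivariant].
Qed.

End XpowCovariant.

Lemma eq_covariant (K : numFieldType) m k (F H : {ffun 'I_k -> symM K m} -> 'M[K]_m) :
  F =1 H -> covariant F -> covariant H.
Proof.
move=> e [Fm Fa Fe]; split=> [v i c x y|v i j nij vij|g v hg]; rewrite -!e.
- exact: Fm.
- exact: Fa nij vij.
- exact: Fe.
Qed.

(** Multilinearity, alternation and equivariance of [H] are inherited from [Xpow] through the
    pointwise equality. *)
Lemma covariant_eq_Xpow (K : numFieldType) m k (H : {ffun 'I_k -> symM K m} -> 'M[K]_m) :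
  (forall v, Xpow K m k v = H v) -> covariant_eq (Xpow K m k) H.
Proof.
move=> e; split=> //; first exact: Xpow_covariant.
by apply: eq_covariant e _; apply: Xpow_covariant.
Qed.

Lemma Xpow_castdeg (K : numFieldType) m d d' (e : d = d') c
    (H : {ffun 'I_d -> symM K m} -> 'M[K]_m) :
  (forall v, Xpow K m d v = c *: H v) ->
  covariant_eq (Xpow K m d') (fun v => c *: castdeg e H v).
Proof.
case: _ / e => eH; apply: covariant_eq_Xpow => v; rewrite eH /castdeg.
by congr (_ *: H _); apply/ffunP => i; rewrite ffunE cast_ord_id.
Qed.

Local Open Scope complex_scope.

Theorem proposition1p8 (R : realType) (n : nat) (hn : (0 < n)%N) :
  exists q1 q2 : R[i],
    [/\ q1 != 0, q2 != 0,
        covariant_eq (Xpow R[i] n.*2 (4 * n - 2))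
          (fun v => q1 *: castdeg (deg_QOmega hn)
                            (wedge (Qform R[i] n) (Omega R[i] n)) v)
      & covariant_eq (Xpow R[i] n.*2 (4 * n - 1))
          (fun v => q2 *: castdeg (deg_QdOmega hn)
                            (wedge (Qform R[i] n) (dOmega R[i] n)) v)].
Proof.
case: n hn => // n hn; pose q : R[i] := kappa _ n / 4 ^+ n.+1.
have q0 : q != 0.
  by rewrite mulf_neq0 ?kappa_neq0 // invr_neq0 // expf_neq0 // pnatr_eq0.
exists q, (- (q / 2)); split=> //.
- by rewrite oppr_eq0 mulf_neq0 // invr_neq0 // pnatr_eq0.
- by apply: Xpow_castdeg => v; apply: Xpow_wedge_Omega.
- by apply: Xpow_castdeg => v; apply: Xpow_wedge_dOmega.
Qed.
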